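(* Let $\mathfrak{n}$ be a characteristically nilpotent Lie algebra such that the ideal $\{x\in\mathfrak{n}:[x,\mathfrak{n}]\subseteq Z(\mathfrak{n})\}$ is contained in the derived subalgebra $\mathfrak{n}^2$, and let $z_0\in\mathfrak{n}$ be a fixed nonzero central element. For any $2n$-dimensional vector space $V_n=\mathrm{span}\langle x_i,y_i:1\le i\le n\rangle$, consider the direct sum $$\mathcal{L}_n(\mathfrak{n},z_0)=\mathfrak{n}\oplus V_n$$ with the skew-symmetric product extended by $[x_i,y_i]=-[y_i,x_i]=z_0$ for $1\le i\le n$ (all other products of basis vectors of $V_n$ being zero), $[V_n,\mathfrak{n}]=0$, and $\mathfrak{n}$ as a subalgebra. Let $b$ be the nondegenerate alternating form on $V_n$ defined by $[u,v]=b(u,v)z_0$ for $u,v\in V_n$. Then $\mathcal{L}_n(\mathfrak{n},z_0)$ is a nilpotent Lie algebra with the same nilindex as $\mathfrak{n}$, and $$\mathrm{Der}\,\mathcal{L}_n(\mathfrak{n},z_0)=\mathfrak{sp}_{2n}(V_n,b)^\star\oplus\mathfrak{N},$$ where $\mathfrak{sp}_{2n}(V_n,b)^\star=\{\delta\in\mathfrak{gl}(\mathcal{L}_n(\mathfrak{n},z_0)):\delta|_{V_n}\in\mathfrak{sp}_{2n}(V_n,b),\ \delta|_{\mathfrak{n}}=0\}$ and $$\begin{array}{rcl}\mathfrak{N}&=&\{\delta:\delta|_{V_n}=0,\ \delta|_{\mathfrak{n}}\in\mathrm{Der}\,\mathfrak{n},\ \delta(z_0)=0\}\ \oplus\\ &&\{\delta:\delta(V_n)\subseteq\mathfrak{n}^2,\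 \delta(\mathfrak{n})\subseteq V_n,\ \delta|_{\mathfrak{n}^2}=0,\ \mathrm{ad}_{\mathfrak{n}}\,\delta(u)=-b(u,\delta(\cdot))z_0\ \ \forall u\in V_n\}\end{array}$$ is a nilpotent ideal which consists of nilpotent linear operators. In particular, any faithful Lie algebra with radical $\mathcal{L}_n(\mathfrak{n},z_0)$ is isomorphic to a Lie algebra of the form $S\oplus_{\mathrm{id}}\mathcal{L}_n(\mathfrak{n},z_0)$ where $S$ is a semisimple subalgebra of the symplectic algebra $\mathfrak{sp}_{2n}(V_n,b)^\star$.
   Context: All vector spaces and algebras are finite-dimensional over a field $k$ of characteristic zero. For a Lie algebra $\mathfrak{n}$: $\mathfrak{n}^1=\mathfrak{n}$, $\mathfrak{n}^{j+1}=[\mathfrak{n},\mathfrak{n}^j]$; the nilindex of a nilpotent $\mathfrak{n}$ is the largest $t$ with $\mathfrak{n}^t\ne0$; $Z(\mathfrak{n})$ is the center; $\mathrm{Der}\,\mathfrak{n}$ is the derivation algebra. With $\mathfrak{D}=\mathrm{Der}\,\mathfrak{n}$, put $\mathfrak{n}^{[1]}=\mathfrak{D}(\mathfrak{n})=\{\sum\delta_i(x_i):x_i\in\mathfrak{n},\delta_i\in\mathfrak{D}\}$ and $\mathfrak{n}^{[k+1]}=\mathfrak{D}(\mathfrak{n}^{[k]})$. The algebra $\mathfrak{n}$ is characteristically nilpotent if $\mathfrak{n}^{[k]}=0$ for some $k$. $\mathfrak{sp}_{2n}(V_n,b)$ is the Lie algebra of $f\in\mathfrak{gl}(V_n)$ with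 $b(f(u),v)+b(u,f(v))=0$. The condition $\mathrm{ad}_{\mathfrak{n}}\,\delta(u)=-b(u,\delta(\cdot))z_0$ means $[\delta(u),a]=-b(u,\delta(a))z_0$ for all $a\in\mathfrak{n}$. A $\delta\in\mathfrak{sp}_{2n}(V_n,b)^\star$ maps $V_n$ into $V_n$. For a solvable Lie algebra $R$ and a semisimple subalgebra $S\subseteq\mathrm{Der}\,R$, $S\oplus_{\mathrm{id}}R$ denotes the vector space $S\oplus R$ with the brackets of $S$ and $R$ and $[s,a]=-[a,s]=s(a)$ for $s\in S$, $a\in R$. A Lie algebra $L$ with solvable radical $R$ and Levi decomposition $L=S\oplus R$ is faithful if the adjoint representation of $S$ on $R$ is faithful (equivalently, $L$ has no nonzero semisimple ideals). *)

(* Defs.v *)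
From HB Require Import structures.
From mathcomp Require Import all_boot all_order all_algebra ring.

Set Implicit Arguments.
Unset Strict Implicit.
Unset Printing Implicit Defensive.

Import GRing.Theory.
Local Open Scope ring_scope.

(* The Jacobi identity is split off from the bilinear alternating product, so
   that it can be asserted about a product that is only known to be
   skew-symmetric. *)
HB.mixin Record Vector_isSkewAlg (K : fieldType) L of Vector K L := {
  lie : L -> L -> L;
  lie_bilinear : bilinear_for *:%R *:%R lie;
  liexx : forall x : L, lie x x = 0
}.

#[short(type="skewAlgType")]
HB.structure Definition SkewAlg (K : fieldType) :=
  { L of Vector_isSkewAlg K L & Vector K L }.

HB.instance Definition _ (K : fieldType) (L : skewAlgType K) :=
  bilinear_isBilinear.Build K L L L *:%R *:%R (@lie K L) (@lie_bilinear K L).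

Definition jacobi (K : fieldType) (L : skewAlgType K) : Prop :=
  forall x y z : L, lie x (lie y z) + lie y (lie z x) + lie z (lie x y) = 0.

HB.mixin Record SkewAlg_isLie (K : fieldType) L of SkewAlg K L := {
  lie_jacobi : jacobi L
}.

#[short(type="lieType")]
HB.structure Definition LieAlg (K : fieldType) :=
  { L of SkewAlg_isLie K L & SkewAlg K L }.

Section GeneralLinear.
Variables (K : fieldType) (V : vectType K).

Definition lfun_comm (f g : 'End(V)) : 'End(V) := ((f \o g)%VF - (g \o f)%VF).

Lemma lfun_comm_bilinear : bilinear_for *:%R *:%R lfun_comm.
Proof.
split=> h a f g /=; rewrite /lfun_comm comp_lfunDr comp_lfunDl.
  by rewrite -comp_lfunZl -comp_lfunZr scalerBr opprD addrACA.
by rewrite -comp_lfunZl -comp_lfunZr scalerBr opprD addrACA.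
Qed.

Lemma lfun_commxx (f : 'End(V)) : lfun_comm f f = 0.
Proof. exact: subrr. Qed.

HB.instance Definition _ :=
  Vector_isSkewAlg.Build K 'End(V) lfun_comm_bilinear lfun_commxx.

Lemma lie_lfunE (f g : 'End(V)) v : lie f g v = f (g v) - g (f v).
Proof. by rewrite !lfun_simp. Qed.

Lemma lfun_comm_jacobi : jacobi ('End(V) : skewAlgType K).
Proof.
move=> f g h; rewrite /lie /= /lfun_comm.
rewrite !(comp_lfunDr, comp_lfunDl, comp_lfunNl, comp_lfunNr, comp_lfunA).
rewrite !(opprD, opprK, addrA).
rewrite (ACl ((1*11)*(2*8)*(3*5)*(4*10)*(6*12)*(7*9))%AC) /=.
by rewrite ?(subrr, addNr, addr0).
Qed.

HB.instance Definition _ := SkewAlg_isLie.Build K 'End(V) lfun_comm_jacobi.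

End GeneralLinear.

(* Subspaces cut out by linear conditions: for phi linear in each argument,
   solv1 U phi = {w | phi w x = 0 for all x in U}, and
   solv2 U U' phi = {w | phi w x y = 0 for all x in U and y in U'}. *)
Section Solutions1.
Variables (K : fieldType) (W A C : vectType K).

Definition solv1 (U : {vspace A}) (phi : W -> A -> C) : {vspace W} :=
  (\bigcap_(i < \dim U) lker (linfun (phi^~ (vbasis U)`_i)))%VS.

Lemma memv_lker_linfun (f : W -> C) (w : W) :
  linear f -> (w \in lker (linfun f)) = (f w == 0).
Proof.
move=> linf; pose m := GRing.isLinear.Build K W C _ f linf.
by rewrite memv_ker (lfunE (HB.pack f m : {linear W -> C})).
Qed.

Lemma eq0_vbasis (U : {vspace A}) (f : A -> C) : linear f ->
    (forall i : 'I_(\dim U), f (vbasis U)`_i = 0) -> {in U, forall x, f x = 0}.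
Proof.
move=> linf f0 x Ux; pose m := GRing.isLinear.Build K A C _ f linf.
pose F : {linear A -> C} := HB.pack f m.
rewrite -[f x]/(F x) (coord_vbasis Ux) linear_sum big1 // => i _.
by rewrite linearZ /= f0 scaler0.
Qed.

Lemma vbasis_nth (U : {vspace A}) (i : 'I_(\dim U)) : (vbasis U)`_i \in U.
Proof. by rewrite vbasis_mem ?mem_nth ?size_tuple. Qed.

Lemma solv1P (U : {vspace A}) (phi : W -> A -> C) (w : W) :
    (forall x, linear (phi^~ x)) -> (forall v, linear (phi v)) ->
  reflect {in U, forall x, phi w x = 0} (w \in solv1 U phi).
Proof.
move=> linl linr; rewrite memvE; apply: (iffP subv_bigcapP) => [sol|sol i _].
  apply: eq0_vbasis (linr w) _ => i; have := sol i isT.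
  by rewrite -memvE memv_lker_linfun // => /eqP.
by rewrite -memvE memv_lker_linfun // sol ?vbasis_nth.
Qed.

End Solutions1.

Section Solutions2.
Variables (K : fieldType) (W A B C : vectType K).

Definition solv2 (U : {vspace A}) (U' : {vspace B}) (phi : W -> A -> B -> C) :
    {vspace W} :=
  (\bigcap_(i < \dim U) solv1 U' (fun w => phi w (vbasis U)`_i))%VS.

Lemma solv2P (U : {vspace A}) (U' : {vspace B}) (phi : W -> A -> B -> C) w :
    (forall x y, linear (fun v => phi v x y)) ->
    (forall v y, linear (fun x => phi v x y)) ->
    (forall v x, linear (phi v x)) ->
  reflect {in U & U', forall x y, phi w x y = 0} (w \in solv2 U U' phi).
Proof.
move=> lin1 lin2 lin3.
rewrite memvE; apply: (iffP subv_bigcapP) => [sol x y Ux U'y|sol i _].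
  move: x Ux; apply: eq0_vbasis (lin2 w y) _ => i; have := sol i isT.
  by rewrite -memvE => /solv1P -> //.
by rewrite -memvE; apply/solv1P => // y U'y; rewrite sol ?vbasis_nth.
Qed.

Lemma solv1_compP (h : A -> W) (g : B -> C) (U : {vspace A}) (f : 'Hom(W, B)) :
    linear h -> linear g ->
  reflect {in U, forall x, g (f (h x)) = 0}
          (f \in solv1 U (fun (f : 'Hom(W, B)) x => g (f (h x)))).
Proof.
move=> linh ling; apply: solv1P => [x a f1 f2|f1 a x1 x2] /=.
  by rewrite !lfun_simp ling.
by rewrite linh linearP ling.
Qed.

End Solutions2.

Section Algebras.
Variables (K : fieldType) (L : skewAlgType K).
Implicit Types (U V W I R S : {vspace L}) (x y : L).

(* [U, V], the span of all brackets *)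
Definition lieV U V : {vspace L} :=
  <<[seq lie x y | x <- vbasis U, y <- vbasis V]>>%VS.

Lemma memv_lie U V : {in U & V, forall x y, lie x y \in lieV U V}.
Proof.
move=> x y /coord_vbasis-> /coord_vbasis->.
rewrite linear_sumlz memv_suml // => i _; rewrite linear_sumr memv_suml // => j _.
rewrite linearZl_LR linearZr_LR !memvZ // memv_span //.
by apply/allpairsP; exists ((vbasis U)`_i, (vbasis V)`_j); rewrite !mem_nth ?size_tuple.
Qed.

Lemma lieVP U V W :
  reflect {in U & V, forall x y, lie x y \in W} (lieV U V <= W)%VS.
Proof.
apply: (iffP idP) => [sUVW x y Ux Vy | sUVW].
  by rewrite (subvP sUVW) ?memv_lie.
apply/span_subvP=> _ /allpairsP[[x y] /= [Ux Vy ->]].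
by rewrite sUVW ?vbasis_mem.
Qed.

(* The lower central series U^1 = U, U^(j+1) = [U, U^j] of a subalgebra U.
   The index starts at 1; the value at 0 is again U. *)
Definition lcs U (j : nat) : {vspace L} := iter j.-1 (lieV U) U.

Definition nilpotent U : Prop := exists t, lcs U t = 0%VS.

Definition nilindex U (t : nat) : Prop :=
  lcs U t <> 0%VS /\ forall s, lcs U s <> 0%VS -> (s <= t)%N.

Definition derived_series U (j : nat) : {vspace L} :=
  iter j (fun W => lieV W W) U.

Definition solvable U : Prop := exists j, derived_series U j = 0%VS.

Definition subalgebra U : Prop := (lieV U U <= U)%VS.

Definition ideal_of I U : Prop := (I <= U)%VS /\ (lieV U I <= I)%VS.

Definition semisimple U : Prop :=
  subalgebra U /\ forall I, ideal_of I U -> solvable I -> I = 0%VS.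

Definition is_radical R : Prop :=
  [/\ ideal_of R fullv, solvable R
    & forall I, ideal_of I fullv -> solvable I -> (I <= R)%VS].

Definition levi_decomposition S R : Prop :=
  [/\ is_radical R, semisimple S, (S + R = fullv)%VS & (S :&: R = 0)%VS].

Definition center : {vspace L} := solv1 fullv (fun x y => lie x y).

Lemma centerP x : reflect (forall y, lie x y = 0) (x \in center).
Proof.
apply: (iffP (solv1P _ _ _ _)).
- by move=> y a u v; rewrite linearPl.
- by move=> u a y y'; rewrite linearPr.
- by move=> h y; rewrite h ?memvf.
- by move=> h y _.
Qed.

Definition Der : {vspace 'End(L)} :=
  solv2 fullv fullv
    (fun (f : 'End(L)) x y => f (lie x y) - (lie (f x) y + lie x (f y))).

Lemma DerP (f : 'End(L)) :
  reflect (forall x y, f (lie x y) = lie (f x) y + lie x (f y)) (f \in Der).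
Proof.
apply: (iffP (solv2P _ _ _ _ _ _)) => [x y a g h|g y a x x'|g x a y y'|h x y|h x y _ _].
- rewrite !lfun_simp linearPl linearPr !(scalerDr, scalerN, opprD, addrA).
  by rewrite (ACl (1*3*5*2*4*6)%AC).
- rewrite !(linearPl, linearP) /= !(scalerDr, scalerN, opprD, addrA).
  by rewrite (ACl (1*3*5*2*4*6)%AC).
- rewrite !(linearPr, linearP) /= !(scalerDr, scalerN, opprD, addrA).
  by rewrite (ACl (1*3*5*2*4*6)%AC).
- by apply/subr0_eq/h; rewrite memvf.
- by rewrite h subrr.
Qed.

(* D(U), the span of all d(x) with d in D and x in U *)
Definition apply_space (D : {vspace 'End(L)}) U : {vspace L} :=
  (\sum_(i < \dim D) (vbasis D)`_i @: U)%VS.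

Lemma apply_spaceP (D : {vspace 'End(L)}) U W :
  reflect {in D & U, forall (d : 'End(L)) x, d x \in W} (apply_space D U <= W)%VS.
Proof.
apply: (iffP subv_sumP) => [sDW d x Dd Ux|sDW i _].
  rewrite (coord_vbasis Dd) sum_lfunE memv_suml // => i _.
  by rewrite lfunE memvZ // (subvP (sDW i isT)) ?memv_img.
by apply/subvP => _ /memv_imgP[x Ux ->]; rewrite sDW ?vbasis_nth.
Qed.

(* n^[k], starting from n^[0] = n *)
Definition der_series (k : nat) : {vspace L} :=
  iter k (apply_space Der) fullv.

Definition characteristically_nilpotent : Prop :=
  exists k, der_series k = 0%VS.

End Algebras.

Section LieHom.
Variables (K : fieldType) (A B : skewAlgType K).

Definition lie_morphism (f : 'Hom(A, B)) : Prop :=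
  forall x y, f (lie x y) = lie (f x) (f y).

Definition isomorphic_to_sub (R : {vspace B}) : Prop :=
  exists f : 'Hom(A, B), [/\ lie_morphism f, lker f = 0%VS & limg f = R].

End LieHom.

Definition lie_isomorphic (K : fieldType) (A B : skewAlgType K) : Prop :=
  isomorphic_to_sub A (fullv : {vspace B}).

Definition faithful (K : fieldType) (g : lieType K) : Prop :=
  exists S R : {vspace g}, levi_decomposition S R /\
    {in S, forall s, {in R, forall a, lie s a = 0} -> s = 0}.

Section SemidirectSum.
Variables (K : fieldType) (R : skewAlgType K) (S : {vspace 'End(R)}).

(* The vector space S + R for a subalgebra S of Der R, with the brackets of S
   and R and [s, a] = s a. *)
Definition id_sum : Type := (subvs_of S * R)%type.

HB.instance Definition _ := Vector.copy id_sum (subvs_of S * R)%type.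

Definition id_sum_lie (p q : id_sum) : id_sum :=
  (vsproj S (lie (vsval p.1) (vsval q.1)),
   lie p.2 q.2 + (vsval p.1 q.2 - vsval q.1 p.2)).

Lemma id_sum_bilinear : bilinear_for *:%R *:%R id_sum_lie.
Proof.
split=> r a p q; congr (_, _) => /=.
- by rewrite linearPl linearP.
- rewrite linearPl !linearP /= !lfun_simp.
  rewrite !(scalerDr, scalerN, opprD, addrA) /=.
  by rewrite (ACl (1*3*5*2*4*6)%AC).
- by rewrite linearPr linearP.
- rewrite linearPr !linearP /= !lfun_simp.
  rewrite !(scalerDr, scalerN, opprD, addrA) /=.
  by rewrite (ACl (1*3*5*2*4*6)%AC).
Qed.

Lemma id_sum_liexx (p : id_sum) : id_sum_lie p p = 0.
Proof. by rewrite /id_sum_lie !liexx linear0 subrr addr0. Qed.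

HB.instance Definition _ :=
  Vector_isSkewAlg.Build K id_sum id_sum_bilinear id_sum_liexx.

End SemidirectSum.

Section SymplecticForm.
Variables (K : fieldType) (V : vectType K) (m : nat) (x y : m.-tuple V).

Let B : (m + m).-tuple V := cat_tuple x y.

(* The form b with b(x_i, y_i) = 1 = - b(y_i, x_i), all other values on the
   basis x_1, ..., x_m, y_1, ..., y_m being zero. *)
Definition symp (u v : V) : K :=
  \sum_(i < m) (coord B (lshift m i) u * coord B (rshift m i) v
                - coord B (rshift m i) u * coord B (lshift m i) v).

Lemma symp_bilinear : bilinear_for *%R *%R symp.
Proof.
split=> w a u v /=; rewrite /symp mulr_sumr -big_split /=; apply: eq_bigr => i _.
  by rewrite !linearP /=; ring.
by rewrite !linearP /=; ring.
Qed.

HB.instance Definition _ :=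
  bilinear_isBilinear.Build K V V K *%R *%R symp symp_bilinear.

Lemma sympxx u : symp u u = 0.
Proof. by apply: big1 => i _; rewrite mulrC subrr. Qed.

Hypothesis xyB : basis_of fullv (x ++ y).

Lemma coord_x i k : coord B k (tnth x i) = (lshift m i == k)%:R.
Proof.
rewrite -(coord_free _ _ (basis_free xyB)) (tnth_nth 0) /= nth_cat size_tuple.
by rewrite ltn_ord.
Qed.

Lemma coord_y i k : coord B k (tnth y i) = (rshift m i == k)%:R.
Proof.
rewrite -(coord_free _ _ (basis_free xyB)) (tnth_nth 0) /= nth_cat size_tuple.
by rewrite ltnNge leq_addr addKn.
Qed.

Lemma sympxr i v : symp (tnth x i) v = coord B (rshift m i) v.
Proof.
rewrite /symp (bigD1 i) //= big1 => [|j /negPf ij]; rewrite !coord_x.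
  by rewrite eqxx eq_lrshift mul1r mul0r subr0 addr0.
by rewrite eq_lshift (eq_sym i) ij eq_lrshift !mul0r subr0.
Qed.

Lemma sympyr i v : symp (tnth y i) v = - coord B (lshift m i) v.
Proof.
rewrite /symp (bigD1 i) //= big1 => [|j /negPf ij]; rewrite !coord_y.
  by rewrite eqxx eq_rlshift mul1r mul0r sub0r addr0.
by rewrite eq_rshift (eq_sym i) ij eq_rlshift !mul0r subr0.
Qed.

Lemma symp_xy i j : symp (tnth x i) (tnth y j) = (i == j)%:R.
Proof. by rewrite sympxr coord_y eq_rshift eq_sym. Qed.

Lemma symp_xx i j : symp (tnth x i) (tnth x j) = 0.
Proof. by rewrite sympxr coord_x eq_lrshift. Qed.

Lemma symp_yy i j : symp (tnth y i) (tnth y j) = 0.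
Proof. by rewrite sympyr coord_y eq_rlshift oppr0. Qed.

Lemma sympC u v : symp u v = - symp v u.
Proof.
rewrite /symp -sumrN; apply: eq_bigr => i _.
by rewrite opprB mulrC [X in _ - X]mulrC.
Qed.

Lemma symp_nondegenerate v : (forall u, symp u v = 0) -> v = 0.
Proof.
move=> v0; rewrite (coord_basis xyB (memvf v)) big1 // => k _.
suff -> : coord B k v = 0 by rewrite scale0r.
rewrite -(splitK k); case: (split k) => i /=; last by rewrite -sympxr.
by apply: oppr_inj; rewrite -sympyr v0 oppr0.
Qed.

End SymplecticForm.

(* The underlying space of L_n(n, z0); z0, x and y only determine its bracket. *)
Definition Ln (K : fieldType) (n : lieType K) (z0 : n) (V : vectType K)
  (m : nat) (x y : m.-tuple V) : Type := (n * V)%type.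

Section HeisenbergSum.
Variables (K : fieldType) (n : lieType K) (z0 : n).
Variables (V : vectType K) (m : nat) (x y : m.-tuple V).
Local Notation b := (symp x y).
Local Notation Lnxy := (Ln z0 x y).

HB.instance Definition _ := Vector.copy Lnxy (n * V)%type.

Definition inn (a : n) : Lnxy := (a, 0).
Definition inV (u : V) : Lnxy := (0, u).

Definition Ln_lie (p q : Lnxy) : Lnxy := (lie p.1 q.1 + b p.2 q.2 *: z0, 0).

Lemma Ln_bilinear : bilinear_for *:%R *:%R Ln_lie.
Proof.
split=> r a p q; congr (_, _) => /=; rewrite ?scaler0 ?addr0 //.
  by rewrite !linearPl scalerDl scalerDr scalerA addrACA.
by rewrite !linearPr scalerDl scalerDr scalerA addrACA.
Qed.

Lemma Ln_liexx (p : Lnxy) : Ln_lie p p = 0.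
Proof. by rewrite /Ln_lie liexx sympxx scale0r addr0. Qed.

HB.instance Definition _ := Vector_isSkewAlg.Build K Lnxy Ln_bilinear Ln_liexx.

Lemma inn_linear : linear inn.
Proof. by move=> a u v; congr (_, _); rewrite /= scaler0 addr0. Qed.

Lemma inV_linear : linear inV.
Proof. by move=> a u v; congr (_, _); rewrite /= scaler0 addr0. Qed.

HB.instance Definition _ := GRing.isLinear.Build K n Lnxy *:%R inn inn_linear.
HB.instance Definition _ := GRing.isLinear.Build K V Lnxy *:%R inV inV_linear.

Lemma lie_inn a c : lie (inn a) (inn c) = inn (lie a c).
Proof. by rewrite /lie /= /Ln_lie /= linear0l scale0r addr0. Qed.

Lemma lie_inV u v : lie (inV u) (inV v) = b u v *: inn z0.
Proof. by rewrite -linearZ /lie /= /Ln_lie /= linear0l add0r. Qed.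

Lemma fst_linear : linear (fun p : Lnxy => p.1). Proof. by []. Qed.
Lemma snd_linear : linear (fun p : Lnxy => p.2). Proof. by []. Qed.
Lemma id_linear : linear (fun p : Lnxy => p). Proof. by []. Qed.

(* the subspaces sp(V, b)^* and the two summands of N, as described by the
   reflection lemmas below *)
Definition sp_star : {vspace 'End(Lnxy)} :=
  (solv1 fullv (fun (d : 'End(Lnxy)) u => (d (inV u)).1)
   :&: solv2 fullv fullv (fun (d : 'End(Lnxy)) u v =>
         (b (d (inV u)).2 v + b u (d (inV v)).2 : K^o)%R)
   :&: solv1 fullv (fun (d : 'End(Lnxy)) a => d (inn a)))%VS.

Definition N_der : {vspace 'End(Lnxy)} :=
  (solv1 fullv (fun (d : 'End(Lnxy)) u => d (inV u))
   :&: solv1 fullv (fun (d : 'End(Lnxy)) a => (d (inn a)).2)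
   :&: solv2 fullv fullv (fun (d : 'End(Lnxy)) a c =>
         (d (inn (lie a c)) - (lie (d (inn a)) (inn c)
                               + lie (inn a) (d (inn c))))%R)
   :&: solv1 <[z0]> (fun (d : 'End(Lnxy)) a => d (inn a)))%VS.

Definition N_mix : {vspace 'End(Lnxy)} :=
  (solv1 fullv (fun (d : 'End(Lnxy)) u => (d (inV u)).2)
   :&: solv1 fullv (fun (d : 'End(Lnxy)) u =>
         ((d (inV u)).1 - projv (lcs fullv 2) (d (inV u)).1)%R)
   :&: solv1 fullv (fun (d : 'End(Lnxy)) a => (d (inn a)).1)
   :&: solv1 (lcs fullv 2) (fun (d : 'End(Lnxy)) a => d (inn a))
   :&: solv2 fullv fullv (fun (d : 'End(Lnxy)) u a =>
         (lie (d (inV u)) (inn a) + b u (d (inn a)).2 *: inn z0)%R))%VS.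

Lemma sp_starP (d : 'End(Lnxy)) :
  reflect [/\ forall u, exists v, d (inV u) = inV v,
              forall u v, b (d (inV u)).2 v + b u (d (inV v)).2 = 0
            & forall a, d (inn a) = 0]
          (d \in sp_star).
Proof.
rewrite !memv_cap -andbA.
have P1 := solv1_compP fullv d inV_linear fst_linear.
have P3 := solv1_compP fullv d inn_linear id_linear.
have P2 : reflect (forall u v, b (d (inV u)).2 v + b u (d (inV v)).2 = 0)
    (d \in solv2 fullv fullv (fun (d : 'End(Lnxy)) u v =>
         (b (d (inV u)).2 v + b u (d (inV v)).2 : K^o)%R)).
  apply: (iffP (solv2P _ _ _ _ _ _)) => [u v k f g|f v k u u'|f u k v v'|h u v|h u v _ _].
  - by rewrite !lfun_simp /= linearPl linearPr scalerDr addrACA.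
  - by rewrite linearP linearP /= !linearPl scalerDr addrACA.
  - by rewrite linearP linearP /= !linearPr scalerDr addrACA.
  - by rewrite h ?memvf.
  - by rewrite h.
apply: (iffP and3P) => [[/P1 h1 /P2 h2 /P3 h3]|[h1 h2 h3]].
  split=> // [u|a]; last by rewrite h3 ?memvf.
  by exists (d (inV u)).2; rewrite [LHS]surjective_pairing h1 ?memvf.
split; [apply/P1 => u _ | exact/P2 | apply/P3 => a _; exact: h3].
by have [v ->] := h1 u.
Qed.

Lemma N_derP (d : 'End(Lnxy)) :
  reflect [/\ forall u, d (inV u) = 0,
              exists2 f : 'End(n), f \in Der n & forall a, d (inn a) = inn (f a)
            & d (inn z0) = 0]
          (d \in N_der).
Proof.
rewrite !memv_cap -!andbA.
have P1 := solv1_compP fullv d inV_linear id_linear.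
have P2 := solv1_compP fullv d inn_linear snd_linear.
have P4 := solv1_compP <[z0]> d inn_linear id_linear.
have P3 : reflect (forall a c, d (inn (lie a c)) =
                     lie (d (inn a)) (inn c) + lie (inn a) (d (inn c)))
    (d \in solv2 fullv fullv (fun (d : 'End(Lnxy)) a c =>
         (d (inn (lie a c)) - (lie (d (inn a)) (inn c)
                               + lie (inn a) (d (inn c))))%R)).
  apply: (iffP (solv2P _ _ _ _ _ _)) => [a c k f g|f c k a a'|f a k c c'|h a c|h a c _ _].
  - rewrite !lfun_simp linearPl linearPr !(scalerDr, scalerN, opprD, addrA).
    by rewrite (ACl (1*3*5*2*4*6)%AC).
  - rewrite !(linearPl, linearP) /= !(scalerDr, scalerN, opprD, addrA).
    by rewrite (ACl (1*3*5*2*4*6)%AC).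
  - rewrite !(linearPr, linearP) /= !(scalerDr, scalerN, opprD, addrA).
    by rewrite (ACl (1*3*5*2*4*6)%AC).
  - by apply/subr0_eq/h; rewrite memvf.
  - by rewrite h subrr.
apply: (iffP and4P) => [[/P1 h1 /P2 h2 /P3 h3 /P4 h4]|[h1 [f /DerP fD fE] h3]].
  have dE a : d (inn a) = inn (d (inn a)).1.
    by rewrite [LHS]surjective_pairing h2 ?memvf.
  have lf : linear (fun a => (d (inn a)).1).
    by move=> k a c; rewrite !linearP.
  pose F : {linear n -> n} :=
    HB.pack (fun a => (d (inn a)).1) (GRing.isLinear.Build _ _ _ _ _ lf).
  have FE a : linfun F a = (d (inn a)).1 by rewrite lfunE.
  split=> [u||]; [by rewrite h1 ?memvf| |by rewrite h4 ?memv_line].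
  exists (linfun F) => [|a]; last by rewrite FE -dE.
  by apply/DerP => a c; rewrite FE h3 (dE a) (dE c) !lie_inn /= !FE.
split; [by apply/P1 => u _ | by apply/P2 => a _; rewrite fE | apply/P3 => a c |].
  by rewrite !fE !lie_inn fD linearD.
by apply/P4 => _ /vlineP[k ->]; rewrite !linearZ /= h3 scaler0.
Qed.

Lemma N_mixP (d : 'End(Lnxy)) :
  reflect [/\ forall u, exists2 a, a \in lcs {:n} 2 & d (inV u) = inn a,
              forall a, exists v, d (inn a) = inV v,
              {in lcs {:n} 2, forall a, d (inn a) = 0}
            & forall u a,
                lie (d (inV u)) (inn a) = - b u (d (inn a)).2 *: inn z0]
          (d \in N_mix).
Proof.
rewrite !memv_cap -!andbA.
have lp : linear (fun p : Lnxy => p.1 - projv (lcs fullv 2) p.1).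
  by move=> k p q; rewrite !linearP /= scalerDr addrACA.
have P1 := solv1_compP fullv d inV_linear snd_linear.
have P2 := solv1_compP fullv d inV_linear lp.
have P3 := solv1_compP fullv d inn_linear fst_linear.
have P4 := solv1_compP (lcs fullv 2) d inn_linear id_linear.
have P5 : reflect (forall u a,
                     lie (d (inV u)) (inn a) = - b u (d (inn a)).2 *: inn z0)
    (d \in solv2 fullv fullv (fun (d : 'End(Lnxy)) u a =>
         (lie (d (inV u)) (inn a) + b u (d (inn a)).2 *: inn z0)%R)).
  apply: (iffP (solv2P _ _ _ _ _ _)) => [u a k f g|f a k u u'|f u k a a'|h u a|h u a _ _].
  - by rewrite !lfun_simp /= linearPl linearPr scalerDl scalerDr scalerA addrACA.
  - by rewrite !linearP !linearPl scalerDl scalerDr scalerA addrACA.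
  - by rewrite !linearP !linearPr scalerDl scalerDr scalerA addrACA.
  - by apply/eqP; rewrite scaleNr -addr_eq0 h ?memvf.
  - by rewrite h scaleNr addNr.
apply: (iffP and5P) => [[/P1 h1 /P2 h2 /P3 h3 /P4 h4 /P5 h5]|[h1 h2 h3 h4]].
  split=> // [u|a].
    exists (d (inV u)).1; last by rewrite [LHS]surjective_pairing h1 ?memvf.
    by rewrite (subr0_eq (h2 u (memvf u))) memv_proj.
  by exists (d (inn a)).2; rewrite [LHS]surjective_pairing h3 ?memvf.
split; [apply/P1|apply/P2|apply/P3|exact/P4|exact/P5] => u _.
- by have [a _ ->] := h1 u.
- by have [a an2 ->] := h1 u; rewrite /= projv_id ?subrr.
- by have [v ->] := h2 u.
Qed.

End HeisenbergSum.

(* Main.v *)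
Require Import Defs.
From HB Require Import structures.
From mathcomp Require Import all_boot all_order all_algebra fieldext ring zify.
From Stdlib Require Import Classical_Prop.

Set Implicit Arguments.
Unset Strict Implicit.
Unset Printing Implicit Defensive.

Import GRing.Theory Num.Theory.
Local Open Scope ring_scope.

(* Write L = n + V.  The four Leibniz identities on n x n, V x n and V x V cut a
   derivation of L into its blocks n -> n, n -> V, V -> n, V -> V, and a derivation
   of n mapping z0 to c z0 must have c = 0 because n is characteristically
   nilpotent; this yields Der L = sp* + N, where N is the set of derivations
   mapping V into n.  A filtration of L shifted by N gives nilpotency.

   For the last part, a Levi factor of g acts on L through a semisimple subalgebra
   S of Der L, and one has to conjugate S into sp*.  Being perfect, S kills n^2 and
   maps L into n^2 + V.  Complete reducibility gives L = W + C with W = S L and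
   C = L^S.  Then W and C commute, and W is the graph of a map from a subspace V'
   of V to n^2.  The projection onto W along C defines q in N_mix with q^3 = 0,
   and exp q carries n into C and V' onto W, so that exp(-q) S exp(q) lies in sp*.

   The splitting L = S L + L^S is derived from the Casimir element and Cartan's
   criterion.  The latter needs no Jordan decomposition over a closed field: if x
   lies in a perfect Lie algebra of matrices with vanishing trace form, pass to a
   field splitting the characteristic polynomial of x, with eigenvalues lam_i of
   multiplicity n_i.  For every rational vector f orthogonal to all rational
   relations between the lam_i, the trace of x against the operator with
   eigenvalues f_i vanishes, so (n_i f_i) is itself a relation, hence f = 0, and
   all lam_i vanish.  Engel's theorem finishes the proof. *)

(** * Nilpotency from vanishing traces *)

(** Irreducibility over a general field need not be decidable, so the induction on the degree splits
    by excluded middle; a reducible [p] has a proper divisor of smaller size. *)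
Lemma irreducible_factor (K : fieldType) (p : {poly K}) : (1 < size p)%N ->
  exists2 q, irreducible_poly q & q %| p.
Proof.
have [k] := ubnP (size p); elim: k p => // k IH p lepk p_gt1.
have [irr_p | red_p] := classic (irreducible_poly p); first by exists p.
have [d [d1 dp dnp]] : exists d : {poly K},
    [/\ size d != 1, d %| p & ~~ (d %= p)].
  apply: NNPP => no_d; apply: red_p; split=> // d d1 dp.
  by apply/negPn/negP => dnp; apply: no_d; exists d.
have p0 : p != 0 by rewrite -size_poly_gt0 ltnW.
have d0 : d != 0 by apply: contraNneq p0 => d0; rewrite -dvd0p -d0.
have ltdp : (size d < size p)%N.
  by rewrite ltn_neqAle dvdp_leq // dvdp_size_eqp // dnp.
have d_gt1 : (1 < size d)%N by rewrite ltn_neqAle eq_sym d1 size_poly_gt0.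
have [|q irr_q qd] := IH d _ d_gt1; first exact: leq_trans ltdp _.
by exists q; last exact: dvdp_trans qd dp.
Qed.

(** Adjoin a root [z] of an irreducible factor, divide by ['X - z%:P] and recurse over the larger
    field. Working up to [%=] absorbs the leading coefficient. *)
Lemma splitting_field (K : fieldType) (p : {poly K}) : p != 0 ->
  exists (F : fieldType) (iota : {rmorphism K -> F}) (rs : seq F),
    map_poly iota p %= \prod_(a <- rs) ('X - a%:P).
Proof.
have [k] := ubnP (size p); elim: k K p => // k IH K p lepk p0.
have [p_le1 | p_gt1] := leqP (size p) 1.
  exists K, idfun, [::]; rewrite big_nil map_poly_id //.
  by rewrite -size_poly_eq1 eqn_leq p_le1 size_poly_gt0.
have [q irr_q qp] := irreducible_factor p_gt1.
have [L _ [z qz _]] := irredp_FAdjoin irr_q.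
have /factor_theorem[r Dp] : root (map_poly (in_alg L) p) z.
  by apply: root_dvdp qz; rewrite ?dvdp_map.
have r0 : r != 0.
  by apply: contraNneq p0 => r0; rewrite -(map_poly_eq0 (in_alg L)) Dp r0 mul0r.
have size_r : (size r < k)%N.
  rewrite -ltnS; apply: leq_trans lepk.
  by rewrite -(size_map_poly (in_alg L)) Dp size_Mmonic ?monicXsubC ?size_XsubC
    ?addn2.
have [F [iota [rs Dr]]] := IH L r size_r r0.
exists F, (iota \o in_alg L), (iota z :: rs).
rewrite map_poly_comp Dp rmorphM /= map_polyXsubC big_cons mulrC.
exact: eqp_mull.
Qed.

(** A singular [A] has a rank factorisation [C R], and [R C] is a nilpotent matrix of smaller size
    with the same trace. An invertible nilpotent matrix has size zero. *)
Lemma mxtrace_nilpotent (F : fieldType) d (A : 'M[F]_d) k :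
  A ^+ k = 0 -> \tr A = 0.
Proof.
have [r] := ubnP d; elim: r d k A => // r IH d k A led Ak.
have [unitA | ] := boolP (A \in unitmx).
  have : \rank (A ^+ k) = d.
    by apply/mxrank_unit; elim: k {Ak} => [|k IHk];
      rewrite ?unitmx1 // exprS unitmx_mul unitA.
  rewrite Ak mxrank0; case: d A {led unitA Ak} => // A _.
  by rewrite /mxtrace big_ord0.
rewrite -row_free_unit /row_free => rk_ne.
have {rk_ne} ltrd : (\rank A < d)%N by rewrite ltn_neqAle rk_ne rank_leq_row.
rewrite -[A in LHS]mulmx_base mxtrace_mulC (IH _ k.+1) //.
  by rewrite -ltnS; apply: leq_trans led.
have expE j : row_base A *m A ^+ j *m col_base A = (row_base A *m col_base A)
  ^+ j.+1.
  elim: j => [|j IHj]; first by rewrite mulmx1.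
  rewrite !exprS in IHj *; rewrite -IHj -[X in _ *m (X * _) *m _]mulmx_base.
  by rewrite -!mulmxE !mulmxA.
by rewrite -expE Ak mulmx0 mul0mx.
Qed.

(** For a rank factorisation [E = C R], cancelling the full-rank outer factors in [C R C R = C R]
    gives [R C = 1], an identity matrix whose size is the rank. *)
Lemma mxtrace_idempotent (F : fieldType) d (E : 'M[F]_d) :
  E *m E = E -> \tr E = (\rank E)%:R.
Proof.
move=> EE; rewrite -[E in LHS]mulmx_base mxtrace_mulC.
suff -> : row_base E *m col_base E = 1%:M by rewrite mxtrace1.
have inj_row m : injective (@mulmx F m _ _ ^~ (row_base E)).
  by apply: row_free_inj; apply: row_base_free.
apply: inj_row; rewrite /= mul1mx.
have /row_fullP[B BC] : row_full (col_base E) by apply: col_base_full.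
have : B *m ((col_base E *m row_base E) *m (col_base E *m row_base E))
         = B *m (col_base E *m row_base E) by rewrite mulmx_base EE.
move: (col_base E) (row_base E) BC => C R BC.
by rewrite !mulmxA BC !mul1mx.
Qed.

Lemma dvdp_prod_coprime (F : fieldType) k (p : 'I_k -> {poly F}) (D : {poly F})
  :
    (forall i j, i != j -> coprimep (p i) (p j)) -> (forall i, p i %| D) ->
  \prod_i p i %| D.
Proof.
move=> cop pD; rewrite -(big_filter _ xpredT) filter_predT.
have := index_enum_uniq 'I_k; elim: (index_enum _) => [|i s IH] /=;
  first by rewrite big_nil dvd1p.
case/andP=> i_s /IH; rewrite big_cons => sD; rewrite Gauss_dvdp ?pD ?sD //.
rewrite big_seq; elim/big_ind: _ => [|q r cq cr|j js]; first exact: coprimep1.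
  by rewrite coprimepMr cq cr.
by apply: cop; apply: contraNneq i_s => ->.
Qed.

(** Chinese remainder theorem: [e i] is 1 modulo [p i] and 0 modulo every other [p j], and [E i] is
    its value at [x]. The identities hold because the product of the [p i] annihilates [x]. *)
Lemma spectral_projections (F : fieldType) d (x : 'M[F]_d.+1) k
    (lam : 'I_k -> F) N : injective lam ->
    horner_mx x (\prod_i ('X - (lam i)%:P) ^+ N) = 0 ->
  exists E : 'I_k -> 'M[F]_d.+1,
    [/\ \sum_i E i = 1, forall i, GRing.comm (E i) x,
        forall i j, i != j -> E i * E j = 0
      & forall i, (x - (lam i)%:M) ^+ N * E i = 0].
Proof.
move=> lam_inj x0; pose p i := ('X - (lam i)%:P) ^+ N.
pose q i := \prod_(j | j != i) p j.
have cop i j : i != j -> coprimep (p i) (p j).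
  move=> ij; apply/coprimep_expl/coprimep_expr;
    rewrite coprimep_XsubC root_XsubC.
  by rewrite (inj_eq lam_inj) eq_sym.
have /fin_all_exists[e eP] i : exists u, q i %| u /\ p i %| 1 - u.
  have /Bezout_eq1_coprimepP[[u v] /= uv] : coprimep (p i) (q i).
    rewrite /q; elim/big_ind: _ => [|r s cr cs|j ji]; first exact: coprimep1.
      by rewrite coprimepMr cr cs.
    by apply: cop; rewrite eq_sym.
  by exists (v * q i); rewrite dvdp_mull // -uv addrK dvdp_mull.
have pe i j : i != j -> p i %| e j.
  move=> ij; apply: dvdp_trans (eP j).1; rewrite /q (bigD1 i) //=.
  exact: dvdp_mulr.
have x0' g : \prod_i p i %| g -> horner_mx x g = 0.
  by case/dvdpP=> h ->; rewrite rmorphM /= x0 mulr0.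
exists (fun i => horner_mx x (e i)); split.
- apply/eqP; rewrite -(rmorph1 (horner_mx x)) -rmorph_sum -subr_eq0 -rmorphB /=.
  apply/eqP/x0'/dvdp_prod_coprime => // j.
  rewrite (bigD1 j) //= addrAC; apply: dvdp_add.
    by rewrite -opprB dvdpNr (eP j).2.
  elim/big_ind: _ => [|r s|i ij]; [exact: dvdp0|exact: dvdp_add|].
  by apply: pe; rewrite eq_sym.
- by move=> i; apply: comm_horner_mx; apply: commr_refl.
- move=> i j ij; rewrite -rmorphM; apply: x0'; apply: dvdp_prod_coprime => // l.
  have [-> | /pe] := eqVneq l i; first by apply: dvdp_mull; exact: pe.
  exact: dvdp_mulr.
- move=> i.
  have -> : x - (lam i)%:M = horner_mx x ('X - (lam i)%:P).
    by rewrite rmorphB /= horner_mx_X horner_mx_C.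
  rewrite -rmorphXn -rmorphM; apply: x0'; apply: dvdp_prod_coprime => // l.
  have [-> | /pe] := eqVneq l i; first exact: dvdp_mulr.
  exact: dvdp_mull.
Qed.

(** * Separating generalised eigencomponents by shifts of an operator *)

Section Shifts.
Variables (F : fieldType) (M : lmodType F) (T : {linear M -> M}).

Definition shift (u : M) (t : F) := T u - t *: u.
Definition shifts := foldl shift.

Lemma shiftP a u v t : shift (a *: u + v) t = a *: shift u t + shift v t.
Proof.
by rewrite /shift linearP !scalerDr opprD !scalerA scalerN scalerA addrACA
  mulrC.
Qed.

Lemma shiftsP a u v ts : shifts (a *: u + v) ts = a *: shifts u ts + shifts v
  ts.
Proof. by rewrite /shifts; elim: ts u v => //= t ts IH u v;
  rewrite shiftP IH. Qed.

Lemma shiftsD u v ts : shifts (u + v) ts = shifts u ts + shifts v ts.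
Proof. by rewrite -[u in LHS]scale1r shiftsP scale1r. Qed.

Lemma shifts0 ts : shifts 0 ts = 0.
Proof. by apply: (addrI (shifts 0 ts)); rewrite -shiftsD !addr0. Qed.

End Shifts.

Section SpectralSeparation.
Variables (F : fieldType) (M : lmodType F) (T : {linear M -> M}) (J : M ->
  Prop).
Hypothesis JP : forall a u v, J u -> J v -> J (a *: u + v).
Hypothesis JT : forall u, J u -> J (T u).

Local Notation sh := (shift T).
Local Notation shifts := (shifts T).

Let JB u v : J u -> J v -> J (u - v).
Proof. by move=> Ju Jv; rewrite addrC -scaleN1r; apply: JP. Qed.

Let J0 u : J u -> J 0.
Proof. by move=> Ju; rewrite -(subrr u); apply: JB. Qed.

Let JZ a u : J u -> J (a *: u).
Proof. by move=> Ju; rewrite -[_ *: _]addr0; apply: JP (J0 Ju). Qed.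

Let shC u s t : sh (sh u s) t = sh (sh u t) s.
Proof.
rewrite /shift ![T (_ - _)]linearB ![T (_ *: _)]linearZ /= !scalerBr !scalerA
  !opprB [t * s]mulrC.
by rewrite addrACA [RHS]addrACA [- _ + _ in RHS]addrC.
Qed.

Let shs_sh u t ts : shifts (sh u t) ts = sh (shifts u ts) t.
Proof. by elim: ts u => //= s ts IH u; rewrite -IH shC. Qed.

Let shsC u ts ts' : shifts (shifts u ts) ts' = shifts (shifts u ts') ts.
Proof. by elim: ts u => //= t ts IH u; rewrite IH shs_sh. Qed.

Let shs_J u ts : J u -> J (shifts u ts).
Proof. by elim: ts u => //= t ts IH u Ju; apply/IH/JB;
  [apply: JT|apply: JZ]. Qed.

(** The shifts of [u] at [s] and [t] differ by a nonzero multiple of [u], so [u] is in [J] once both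
    are; induction on [ts] puts the shift at [s] into [J]. *)
Let shift_in t u ts : t \notin ts -> shifts u ts = 0 -> J (sh u t) -> J u.
Proof.
elim: ts u => [|s ts IH] u /=; first by move=> _ -> /J0.
rewrite inE negb_or => /andP[ts' t_ts] us Jut.
have Jus : J (sh u s).
  by apply: IH => //; rewrite shC; apply: JB; [apply: JT|apply: JZ].
have -> : u = (s - t)^-1 *: (sh u t - sh u s).
  rewrite /shift opprB [X in _ *: X]addrC addrA subrK -scalerBl scalerA mulVf
    ?scale1r //.
  by rewrite subr_eq0 eq_sym.
by apply/JZ/JB.
Qed.

Let shifts_in t u ts N : t \notin ts -> shifts u ts = 0 ->
  J (shifts u (nseq N t)) -> J u.
Proof.
move=> t_ts; elim: N u => //= N IH u uts Jut.
apply: (shift_in t_ts uts); apply: IH => //.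
by rewrite shs_sh uts; apply: (shifts0 T [:: t]).
Qed.

(* J contains the generalised eigencomponents of each of its elements. *)
Lemma spectral_separation (I : eqType) (s : seq I) (c mu : I -> F) (h : I -> M)
  N :
    (forall i j, mu i = mu j -> c i = c j) ->
    (forall i, shifts (h i) (nseq N (mu i)) = 0) ->
  J (\sum_(i <- s) h i) -> J (\sum_(i <- s) c i *: h i).
Proof.
move=> c_mu hN; have [k] := ubnP (size s); elim: k s => // k IH [|i0 s] les.
  by rewrite !big_nil.
pose s1 := [seq i <- i0 :: s | mu i != mu i0].
have shs_sum P ts (s' : seq I) : shifts (\sum_(i <- s' | P i) h i) ts =
    \sum_(i <- s' | P i) shifts (h i) ts.
  by elim/big_rec2: _ => [|i u v _ <-]; rewrite ?shifts0 ?shiftsD.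
rewrite (bigID (fun i => mu i == mu i0)) /= -[X in _ + X]big_filter -/s1.
set A := \sum_(i <- _ | _) _; set B := \sum_(i <- _) _ => JAB.
have sub1 : (size s1 < k)%N.
  rewrite /s1 /= eqxx /= size_filter.
  by apply: leq_ltn_trans (count_size _ _) _; rewrite -ltnS.
(* [N] shifts at [mu i0] kill [A], so they send [B] into [J]. Since [B] is killed by shifts at other
   eigenvalues, these [N] shifts can be undone inside [J]. *)
have JB' : J B.
  apply: (@shifts_in (mu i0) B (flatten [seq nseq N (mu i) | i <- s1]) N).
  - apply/flattenP => -[_ /mapP[i i_s1 ->]] /nseqP[mui _].
    by move: i_s1; rewrite mem_filter mui eqxx.
  - rewrite /B; elim: s1 {B sub1 JAB} => [|i s1 IH1]; first by rewrite big_nil.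
    by rewrite big_cons /= [shifts _ _]foldl_cat -!/(shifts _ _) shiftsD hN
      add0r shsC IH1 shifts0.
  - have := shs_J (nseq N (mu i0)) JAB;
      rewrite shiftsD [X in X + _](_ : _ = 0) ?add0r //.
    by rewrite shs_sum big1 // => i /eqP <-; apply: hN.
rewrite (bigID (fun i => mu i == mu i0)) /= -[X in _ + X]big_filter -/s1.
rewrite (eq_bigr (fun i => c i0 *: h i)); last by move=> i /eqP/c_mu ->.
by rewrite -scaler_sumr; apply: JP; [rewrite -[X in J X](addrK B);
  apply: JB | apply: IH].
Qed.

End SpectralSeparation.

(** Turns the rational relations between eigenvalues, known only as a predicate, into a matrix.
    Excluded middle tells whether some vector of [P] is still missing; adding it raises the rank,
    which is at most [k]. *)
Lemma rowspace_of_pred (F : fieldType) k (P : 'rV[F]_k -> Prop) :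
    P 0 -> (forall a u v, P u -> P v -> P (a *: u + v)) ->
  exists B : 'M[F]_k, forall u, (u <= B)%MS <-> P u.
Proof.
move=> P0 PP; pose sound (B : 'M[F]_k) := forall u, (u <= B)%MS -> P u.
suff ext m (B : 'M_k) : sound B -> (k - \rank B <= m)%N ->
    exists C : 'M[F]_k, forall u, (u <= C)%MS <-> P u.
  by apply: (ext k 0); [move=> u; rewrite submx0 => /eqP-> | rewrite leq_subr].
elim: m B => [|m IH] B sB lem.
  exists B => u; split=> [/sB // | _]; apply: submx_full.
  by rewrite /row_full eqn_leq rank_leq_col -subn_eq0 -leqn0.
have [full|not_full] := classic (forall u, P u -> (u <= B)%MS).
  by exists B => u; split; [apply: sB | apply: full].
have [u [Pu uB]] : exists u, P u /\ ~~ (u <= B)%MS.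
  apply: NNPP => no_u; apply: not_full => u Pu; apply/negPn/negP => uB.
  by apply: no_u; exists u.
apply: (IH (B + u)%MS) => [w /sub_addsmxP[[a b] /= ->]|].
  rewrite -[b *m u]scale1r addrC; apply: (PP); last by apply: sB;
    rewrite submxMl.
  by rewrite [b]mx11_scalar mul_scalar_mx -[_ *: u]addr0; apply: PP.
have: (\rank B < \rank (B + u)%MS)%N.
  rewrite ltn_neqAle mxrankS ?addsmxSl // andbT.
  apply: contra uB => /eqP rk; have := mxrank_leqif_sup (addsmxSl B u).
  by case=> _; rewrite rk eqxx => /esym; rewrite addsmx_sub => /andP[].
have := rank_leq_col (B + u)%MS; move: lem; clear.
by lia.
Qed.

Section RatInCharZero.
Variables (F : fieldType) (charF : [pchar F] =i pred0).

Lemma intr_char0_eq0 (z : int) : (z%:~R == 0 :> F) = (z == 0).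
Proof.
by case: z => k; rewrite ?NegzE ?mulrNz ?oppr_eq0 -pmulrn ((pcharf0P F).1
  charF).
Qed.

(** In characteristic zero denominators stay nonzero in [F]; clearing them leaves an identity
    between integers, which is verified in [rat]. *)
Lemma ratr_char0_linear a (u v : rat) :
  ratr (a * u + v) = ratr a * ratr u + ratr v :> F.
Proof.
have den0 w : (denq w)%:~R != 0 :> F by rewrite intr_char0_eq0 denq_eq0.
suff : numq (a * u + v) * (denq a * denq u * denq v) =
    (numq a * numq u * denq v + numq v * denq a * denq u) * denq (a * u + v).
  move/(congr1 (intr : int -> F)); rewrite !(rmorphM, rmorphD) /= => E.
  rewrite /ratr; apply: (mulIf (den0 (a * u + v))); rewrite divfK //.
  apply: (mulIf (mulf_neq0 (mulf_neq0 (den0 a) (den0 u)) (den0 v))); rewrite E.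
  by field; rewrite !den0.
apply: (@intr_inj rat); rewrite !(rmorphM, rmorphD) /= !numqE.
by ring.
Qed.

End RatInCharZero.

(** * Vanishing traces force nilpotency: the split case, then descent to the base field *)

Section NilpotentOfTrace.
Variables (F : fieldType) (charF : [pchar F] =i pred0).
Variables (d r : nat) (A : 'I_r -> 'M[F]_d.+1) (x : 'M[F]_d.+1).
Let J (g : 'M[F]_d.+1) := exists c, g = \sum_j c j *: A j.
Hypothesis xA : forall i, J (x * A i - A i * x).
Hypothesis x_comm : exists c : 'I_r -> 'I_r -> F,
  x = \sum_i \sum_j c i j *: (A i * A j - A j * A i).
Hypothesis trA : forall i j, \tr (A i * A j) = 0.

Let JP a u v : J u -> J v -> J (a *: u + v).
Proof.
move=> [c ->] [c' ->]; exists (fun j => a * c j + c' j).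
by rewrite scaler_sumr -big_split; apply: eq_bigr => j _;
  rewrite scalerDl scalerA.
Qed.

Let J0 : J 0.
Proof. by exists (fun => 0); rewrite big1 // => j _; rewrite scale0r. Qed.

Let T : {linear 'M[F]_d.+1 -> 'M[F]_d.+1} := mulmx x \- mulmxr x.

Let TE g : T g = x * g - g * x. Proof. by []. Qed.

Let JT g : J g -> J (T g).
Proof.
case=> c ->; rewrite linear_sum; elim/big_rec: _ => // j v _ Jv.
by rewrite linearZ /=; apply: JP => //; apply: xA.
Qed.

(** On the block [E i * g * E j] the shifted [T] is left multiplication by [x - lam i] minus right
    multiplication by [x - lam j]. These commute and their [N]-th powers vanish there, whence the
    exponent [N + N]. *)
Let ad_block_nilpotent k (lam : 'I_k -> F) (E : 'I_k -> 'M[F]_d.+1) N i j g :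
    (forall i, (x - (lam i)%:M) ^+ N * E i = 0) ->
    (forall i, GRing.comm (E i) x) ->
  shifts T (E i * g * E j) (nseq (N + N) (lam i - lam j)) = 0.
Proof.
move=> EN Ex.
(* With separate exponents for the two sides, one shift yields two terms, each lowering one
   exponent. *)
suff gen a b (u : 'M[F]_d.+1) : (x - (lam i)%:M) ^+ a * u = 0 ->
    u * (x - (lam j)%:M) ^+ b = 0 ->
    shifts T u (nseq (a + b) (lam i - lam j)) = 0.
  apply: gen; first by rewrite !mulrA EN !mul0r.
  have cE : GRing.comm (E j) ((x - (lam j)%:M) ^+ N).
    by apply: commrX; apply: commrB; [apply: Ex | apply: comm_mx_scalar].
  by rewrite -mulrA cE EN mulr0.
have [n] := ubnP (a + b); elim: n a b u => // n IH [|a] [|b] u lab.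
- by rewrite mul1r => ->; rewrite shifts0.
- by rewrite mul1r => ->; rewrite shifts0.
- by rewrite mulr1 => _ ->; rewrite shifts0.
rewrite addSn => ua ub;
  rewrite -[LHS]/(shifts T (shift T u (lam i - lam j)) (nseq (a + b.+1) _)).
have -> : shift T u (lam i - lam j) =
    -1 *: (u * (x - (lam j)%:M)) + (x - (lam i)%:M) * u.
  rewrite [RHS]addrC /shift TE mulrBl mulrBr -!mulmxE mul_scalar_mx
    mul_mx_scalar.
  by rewrite scaleN1r scalerBl !opprB addrACA [RHS]addrACA [X in _ = _ +
    X]addrC.
have lab' : (a + b.+1 < n)%N by rewrite -ltnS -addSn.
have va : shifts T ((x - (lam i)%:M) * u) (nseq (a + b.+1) (lam i - lam j)) = 0.
  by apply: (IH a b.+1) => //;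
    [rewrite mulrA -exprSr | rewrite -mulrA ub mulr0].
have vb : shifts T (u * (x - (lam j)%:M)) (nseq (a + b.+1) (lam i - lam j)) = 0.
  rewrite addnS -addSn; apply: (IH a.+1 b); first by rewrite addSnnS.
    by rewrite mulrA ua mul0r.
  by rewrite -mulrA -exprS.
by rewrite shiftsP va vb scaler0 addr0.
Qed.

Let exists_projections rs : char_poly x = \prod_(a <- rs) ('X - a%:P) ->
  exists k (lam : 'I_k -> F) (E : 'I_k -> 'M[F]_d.+1),
    [/\ \sum_i E i = 1, forall i, GRing.comm (E i) x,
        forall i j, i != j -> E i * E j = 0
      & exists2 N, (0 < N)%N & forall i, (x - (lam i)%:M) ^+ N * E i = 0].
Proof.
move=> rsE; pose s := undup rs; pose lam (i : 'I_(size s)) := s`_i.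
have lam_inj : injective lam.
  by move=> i j /eqP; rewrite nth_uniq ?undup_uniq ?ltn_ord // => /eqP/val_inj.
have [|E [E1 Ex EE EN]] := @spectral_projections F d x _ lam (size rs).+1
  lam_inj.
  have /dvdpP[q ->] : char_poly x %| \prod_i ('X - (lam i)%:P) ^+ (size rs).+1.
    rewrite prodrXl rsE; apply: dvdp_trans (dvdp_exp2l _ (leqnSn _)).
    have: {subset rs <= s} by move=> a; rewrite mem_undup.
    elim: {1 2 3}rs => [|a rs' IH] root_in; first by rewrite big_nil dvd1p.
    rewrite big_cons exprS dvdp_mul ?IH // => [|b brs]; last first.
      by apply: root_in; rewrite inE brs orbT.
    have /(nthP 0)[j ltj Ea] : a \in s by apply: root_in; rewrite mem_head.
    by rewrite (bigD1 (Ordinal ltj)) //= /lam /= Ea dvdp_mulr.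
  by rewrite rmorphM /= Cayley_Hamilton mulr0.
by exists (size s), lam, E; split=> //; exists (size rs).+1.
Qed.

Lemma nilpotent_of_trace_split rs : char_poly x = \prod_(a <- rs) ('X - a%:P) ->
  exists N, x ^+ N = 0.
Proof.
case/exists_projections=> k [lam [E [E1 Ex EE [N N_gt0 EN]]]]; exists N.
have EEi i : E i * E i = E i.
  rewrite -[RHS]mulr1 -E1 mulr_sumr (bigD1 i) //= big1 ?addr0 // => j ji.
  by rewrite EE // eq_sym.
have ratrP := ratr_char0_linear charF.
have ratr0 : ratr 0 = 0 :> F by rewrite (ratr_nat F 0).
have ratrB u v : ratr (u - v) = ratr u - ratr v :> F.
  by rewrite addrC -mulN1r ratrP (ratr_int F (-1)) mulN1r addrC.
pose S (u : 'rV[rat]_k) : F := \sum_i ratr (u 0 i) * lam i.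
have SP a u v : S (a *: u + v) = ratr a * S u + S v.
  rewrite mulr_sumr -big_split; apply: eq_bigr => i _.
  by rewrite /= !mxE ratrP mulrDl [in RHS]mulrA.
have SB u v : S (u - v) = S u - S v.
  by rewrite addrC -scaleN1r SP (ratr_int F (-1)) mulN1r addrC.
pose rel u := S u = 0.
have [|a u v ru rv|B BP] := @rowspace_of_pred _ k rel.
- by rewrite /rel -(subr0 0) SB subrr.
- by rewrite /rel SP ru rv mulr0 addr0.
(* The columns of [C] span the rational vectors orthogonal to all relations; each column serves as
   [f] below. *)
have [C CP] : exists C : 'M_k, forall u, rel u <-> u *m C = 0.
  exists (cokermx B) => u; rewrite -BP submxE.
  by split=> [/eqP|->].
have coker_rel j u : rel u -> \sum_i u 0 i * C i j = 0.
  by move=> /CP/matrixP/(_ 0 j); rewrite !mxE.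
have trE i : \tr (x * E i) = lam i * (\rank (E i))%:R.
  rewrite -(subrK (lam i)%:M x) mulrDl raddfD /= -mulmxE mul_scalar_mx mxtraceZ.
  rewrite (mxtrace_idempotent (EEi i)) (@mxtrace_nilpotent _ _ _ N) ?add0r //
    mulmxE.
  rewrite exprMn_comm; last by apply/commr_sym/commrB;
    [apply: Ex | apply: comm_mx_scalar].
  have -> : E i ^+ N = E i.
    by case: (N) N_gt0 => // n' _; elim: n' => // n' IH; rewrite exprS IH EEi.
  by rewrite EN.
have rk0 i j : (\rank (E i))%:R * C i j = 0.
  pose f i := C i j; pose y := \sum_i ratr (f i) *: E i.
  have Sdelta i1 i2 : S (delta_mx 0 i1 - delta_mx 0 i2) = lam i1 - lam i2.
    have Sd l : S (delta_mx 0 l) = lam l.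
      rewrite /S (bigD1 l) //= big1 => [|l' /negPf ll'];
        last by rewrite mxE ll' andbF ratr0 mul0r.
      by rewrite mxE !eqxx (ratr_nat F 1) mul1r addr0.
    by rewrite SB !Sd.
  (* Equal differences of eigenvalues give an integral relation, to which [f] is orthogonal. Hence
     the factor by which [ad y] scales a block depends only on the eigenvalue of [ad x] there. *)
  have f_lam p q : lam p.1 - lam p.2 = lam q.1 - lam q.2 ->
      ratr (f p.1 - f p.2) = ratr (f q.1 - f q.2) :> F.
    rewrite -!Sdelta => /eqP; rewrite -subr_eq0 -SB => /eqP/CP.
    rewrite !mulmxBl -!rowE => /rowP/(_ j); rewrite !mxE => /eqP.
    by rewrite subr_eq0 => /eqP; rewrite /f => ->.
  (* [ad y] multiplies the block [h p] by [f p.1 - f p.2], so it preserves [J] by spectral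
     separation for [ad x]. *)
  have yJ g : J g -> J (y * g - g * y).
    move=> Jg; pose h (p : 'I_k * 'I_k) := E p.1 * g * E p.2.
    have gE : g = \sum_p h p.
      rewrite -[LHS]mul1r -[LHS]mulr1 -E1 mulr_suml mulr_suml -(pair_bigA _
        (fun i j => h (i, j))).
      by apply: eq_bigr => i1 _; rewrite mulr_sumr.
    rewrite [y * g - _](_ : _ = \sum_p ratr (f p.1 - f p.2) *: h p).
      apply: (@spectral_separation _ _ T J JP JT _ _ _ (fun p => lam p.1 - lam
        p.2) h (N + N)).
      - exact: f_lam.
      - by move=> p; apply: ad_block_nilpotent.
      - by rewrite -gE.
    rewrite -(pair_bigA _ (fun i j => ratr (f i - f j) *: h (i, j))) /=.
    under eq_bigr do under eq_bigr do rewrite ratrB scalerBl.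
    under eq_bigr do rewrite sumrB; rewrite sumrB; congr (_ - _).
      rewrite /y -[LHS]mulr1 -E1 mulr_suml mulr_suml; apply: eq_bigr => i1 _.
      by rewrite mulr_sumr; apply: eq_bigr => i2 _; rewrite -!scalerAl.
    rewrite exchange_big /= /y -[LHS]mul1r -E1 mulrA mulr_sumr;
      apply: eq_bigr => i1 _.
    rewrite -scalerAr !mulr_suml scaler_sumr; apply: eq_bigr => i2 _;
      by rewrite /h.
  have trJ l g : J g -> \tr (A l * g) = 0.
    case=> c ->; rewrite mulr_sumr raddf_sum big1 // => l' _.
    by rewrite -scalerAr /= mxtraceZ trA mulr0.
  (* [x] is a combination of commutators [[A l, A l']], and the trace of [[A l, A l'] y] is minus
     that of [A l [y, A l']], where the bracket lies in [J]. *)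
  have trxy : \tr (x * y) = 0.
    case: x_comm => c ->; rewrite mulr_suml raddf_sum big1 // => l _.
    rewrite mulr_suml raddf_sum big1 // => l' _.
    have trc : \tr ((A l * A l' - A l' * A l) * y) = - \tr (A l * (y * A l' - A
      l' * y)).
      rewrite -!mulmxE mulmxBl mulmxBr !raddfB /= !mulmxA opprK [LHS]addrC;
        congr (- _ + _).
      by rewrite -[in LHS]mulmxA mxtrace_mulC.
    rewrite -scalerAl /= mxtraceZ trc trJ ?oppr0 ?mulr0 //; apply: yJ.
    exists (fun j => (j == l')%:R);
      rewrite (bigD1 l') //= eqxx scale1r big1 ?addr0 //.
    by move=> l'' /negPf->; rewrite scale0r.
  (* The trace of [x * y] is the sum of [rank (E i) * f i * lam i], so these weights form a
     relation. Orthogonality to [f] makes the sum of the nonnegative rationals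
     [rank (E i) * f i ^ 2] vanish. *)
  have /coker_rel : rel (\row_i ((\rank (E i))%:R * f i)).
    rewrite /rel -trxy /y mulr_sumr raddf_sum; apply: eq_bigr => l _.
    rewrite mxE -scalerAr /= mxtraceZ trE -[_ * f l]addr0 ratrP ratr0 addr0
      ratr_nat.
    by ring.
  move/(_ j) => /eqP; rewrite psumr_eq0 => [/allP/(_ i)|l _];
    rewrite mxE -mulrA.
    rewrite mem_index_enum => /(_ isT);
      rewrite !mulf_eq0 orbb -mulf_eq0 => /eqP.
    by [].
  by rewrite mulr_ge0 // -expr2 sqr_ge0.
(* All columns of [C] vanish at [i] once multiplied by the rank, so the [i]-th unit vector times the
   rank is itself a relation. *)
have rk_lam i : (\rank (E i))%:R * lam i = 0.
  have : rel (\row_l (if l == i then (\rank (E i))%:R else 0)).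
    apply/CP/rowP=> j; rewrite !mxE.
    rewrite (bigD1 i) //= big1 => [|l /negPf li]; last by rewrite mxE li mul0r.
    by rewrite mxE eqxx rk0 addr0.
  rewrite /rel /S (bigD1 i) //= big1 => [|l /negPf li];
    last by rewrite mxE li ratr0 mul0r.
  by rewrite mxE eqxx ratr_nat addr0.
rewrite -[LHS]mulr1 -E1 mulr_sumr big1 // => i _.
have /eqP := rk_lam i; rewrite mulf_eq0 ((pcharf0P F).1 charF) mxrank_eq0.
by case/orP=> [/eqP->|/eqP lam0]; rewrite ?mulr0 // -(EN i) lam0 raddf0 subr0.
Qed.

End NilpotentOfTrace.

Lemma nilpotent_of_trace (K : fieldType) (charK : [pchar K] =i pred0) d r
    (A : 'I_r -> 'M[K]_d) (x : 'M[K]_d) :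
    (forall i, exists c, x * A i - A i * x = \sum_j c j *: A j) ->
    (exists c : 'I_r -> 'I_r -> K,
      x = \sum_i \sum_j c i j *: (A i * A j - A j * A i)) ->
    (forall i j, \tr (A i * A j) = 0) ->
  exists N, x ^+ N = 0.
Proof.
case: d => [|d] in A x *; first by exists 0; rewrite [RHS]flatmx0 [LHS]flatmx0.
move=> xA [c x_comm] trA.
have x0 : char_poly x != 0 by apply/monic_neq0/char_poly_monic.
have [F [iota [rs rsE]]] := splitting_field x0.
have [|i||||N xN] := @nilpotent_of_trace_split F _ d r (fun i => map_mx iota (A
  i)) (map_mx iota x) _ _ _ rs.
- by move=> p; rewrite (fmorph_pchar iota).
- have [c' E] := xA i; exists (fun j => iota (c' j)).
  rewrite -!rmorphM -rmorphB E raddf_sum; apply: eq_bigr => j _.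
  by rewrite /= map_mxZ.
- exists (fun i j => iota (c i j)); rewrite {1}x_comm raddf_sum;
    apply: eq_bigr => i _.
  rewrite raddf_sum; apply: eq_bigr => j _.
  by rewrite /= map_mxZ rmorphB !rmorphM.
- by move=> i j; rewrite -rmorphM trace_map_mx trA rmorph0.
- rewrite -map_char_poly; apply/eqP; rewrite -eqp_monic //.
    by rewrite map_char_poly char_poly_monic.
  exact: monic_prod_XsubC.
exists N; apply: (map_mx_inj (f := iota)).
by rewrite rmorphXn /= xN raddf0.
Qed.

Lemma span_ind (K : fieldType) (V : vectType K) (s : seq V) (Q : V -> Prop) :
    Q 0 -> (forall a u v, Q u -> Q v -> Q (a *: u + v)) ->
  {in s, forall v, Q v} -> {in <<s>>%VS, forall v, Q v}.
Proof.
move=> Q0 QP Qs v; rewrite -[s]/(tval (in_tuple s)) => /coord_span->.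
elim/big_rec: _ => // i u _ Qu; apply: QP => //; apply: Qs.
by rewrite mem_nth ?size_tuple.
Qed.

Lemma lieV_ind (K : fieldType) (L : skewAlgType K) (U V : {vspace L}) (Q : L ->
  Prop) :
    Q 0 -> (forall a u v, Q u -> Q v -> Q (a *: u + v)) ->
    {in U & V, forall u v, Q (lie u v)} ->
  {in lieV U V, forall w, Q w}.
Proof.
move=> Q0 QP QUV; apply: span_ind => // _ /allpairsP[[u v] /= [Uu Vv ->]].
by apply: QUV; apply: vbasis_mem.
Qed.

(** * Traces of endomorphisms, read off from matrices *)

Section EndTrace.
Import passmx.
Variables (K : fieldType) (U : vectType K).
Implicit Types f g : 'End(U).

Let e := vbasis {:U}.
Let eP : basis_of {:U} e. Proof. exact: vbasisP. Qed.

Definition lftrace f : K := \tr (mxof e e f).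

Lemma lftrace_linear : linear_for *%R lftrace.
Proof. by move=> a f g; rewrite /lftrace !linearP. Qed.

HB.instance Definition _ :=
  GRing.isLinear.Build K 'End(U) K *%R lftrace lftrace_linear.

Lemma lftraceC f g : lftrace (f \o g)%VF = lftrace (g \o f)%VF.
Proof. by rewrite /lftrace !(mxof_comp e _ eP) mxtrace_mulC. Qed.

Lemma mxof_iter f N v : rVof e (iter N f v) = rVof e v *m mxof e e f ^+ N.
Proof.
elim: N => [|N IH]; first by rewrite expr0 mulmx1.
by rewrite iterS exprSr -mulmxE mulmxA -IH -rVof_app.
Qed.

Lemma lftrace_nilpotent f N : (forall v, iter N f v = 0) -> lftrace f = 0.
Proof.
move=> fN; apply: (@mxtrace_nilpotent _ _ _ N).
apply/row_matrixP=> i; rewrite row0 rowE -[delta_mx 0 i](vecofK eP) -mxof_iter.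
by rewrite fN linear0.
Qed.

Lemma nilpotent_of_lftrace (charK : [pchar K] =i pred0) (P : {vspace 'End(U)}) :
    lieV P P = P -> {in P &, forall f g, lftrace (f \o g)%VF = 0} ->
  {in P, forall f, exists N, forall v, iter N f v = 0}.
Proof.
move=> PP tr0 f Pf; pose A (i : 'I_(\dim P)) := mxof e e (vbasis P)`_i.
have lieE g h : mxof e e (lie g h) = mxof e e h * mxof e e g - mxof e e g *
  mxof e e h.
  by rewrite linearB /= !(mxof_comp e _ eP).
have [i||i j|N fN] := @nilpotent_of_trace K charK _ _ A (mxof e e f).
- have /coord_vbasis : lie (vbasis P)`_i f \in P.
    by move: (_`_i) (vbasis_nth i) => g Pg; rewrite -PP memv_lie.
  move/(congr1 (mxof e e)); rewrite lieE linear_sum => E.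
  exists (fun j => coord (vbasis P) j (lie (vbasis P)`_i f)); rewrite E.
  by apply: eq_bigr => j _; rewrite linearZ.
- have : f \in lieV P P by rewrite PP.
  move: f {Pf}; apply: span_ind.
  + exists (fun _ _ => 0); rewrite linear0 big1 // => i _;
      rewrite big1 // => j _.
    by rewrite scale0r.
  + move=> a u v [c Ec] [c' Ec']; exists (fun i j => a * c i j + c' i j).
    rewrite linearP /= Ec Ec' scaler_sumr -big_split; apply: eq_bigr => i _ /=.
    rewrite scaler_sumr -big_split; apply: eq_bigr => j _ /=.
    by rewrite scalerA scalerDl.
  + move=> _ /allpairsP[[g h] /= [/(nthP 0)[i lti <-] /(nthP 0)[j ltj <-] ->]].
    rewrite size_tuple in lti; rewrite size_tuple in ltj.
    (* The indices are swapped because [mxof] uses row vectors and reverses composition, as in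
       [lieE]. *)
    exists (fun k l => if (k == j :> nat) && (l == i :> nat) then 1 else 0).
    rewrite lieE (bigD1 (Ordinal ltj)) //= [X in _ = _ + X]big1 => [|k /negPf
      kj]; last first.
      by apply: big1 => l _; rewrite -(inj_eq val_inj) /= in kj;
        rewrite kj scale0r.
    rewrite (bigD1 (Ordinal lti)) //= [X in _ = _ + X + _]big1 => [|l /negPf
      li]; last first.
      by rewrite -(inj_eq val_inj) /= in li; rewrite li andbF scale0r.
    by rewrite !eqxx scale1r !addr0.
- rewrite -mulmxE /A -(mxof_comp e _ eP) -/(lftrace _).
  by rewrite tr0 ?vbasis_nth.
exists N => v; apply/eqP; rewrite -(rVof_eq0 eP) mxof_iter fN.
by rewrite mulmx0.
Qed.
End EndTrace.

(** * Engel's theorem and Cartan's criterion *)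

Lemma vspace_chain_stable (K : fieldType) (V : vectType K) (u : nat -> {vspace
  V}) :
  (forall k, (u k.+1 <= u k)%VS) -> exists k, u k.+1 = u k.
Proof.
have [d] := ubnP (\dim (u 0)); elim: d u => // d IH u led mono.
have [u1 | u1] := eqVneq (u 1) (u 0); first by exists 0.
have [|k uk] := IH (u \o succn) _ (fun k => mono k.+1); last by exists k.+1.
have ltu : (\dim (u 1) < \dim (u 0))%N.
  by rewrite ltnNge; apply: contra u1; rewrite eqEdim mono.
exact: leq_trans ltu led.
Qed.

Lemma lieC (K : fieldType) (L : skewAlgType K) (u v : L) : lie u v = - lie v u.
Proof.
apply/eqP; rewrite -addr_eq0; apply/eqP; have := liexx (u + v).
by rewrite linearDl !linearDr /= !liexx add0r addr0.
Qed.

Section Action.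
Variables (K : fieldType) (V : vectType K).
Implicit Types (D P Q : {vspace 'End(V)}) (U W : {vspace V}) (c : seq 'End(V)).

Definition actv D U : {vspace V} := (\sum_(i < \dim D) (vbasis D)`_i @: U)%VS.

Lemma memv_actv D U : {in D & U, forall (d : 'End(V)) u, d u \in actv D U}.
Proof.
move=> d u /coord_vbasis-> Uu; rewrite sum_lfunE memv_suml // => i _.
by rewrite lfunE memvZ // (subvP (sumv_sup i _ (subvv _))) // memv_img.
Qed.

Lemma actv_ind D U (R : V -> Prop) :
    R 0 -> (forall a u v, R u -> R v -> R (a *: u + v)) ->
    {in D & U, forall (d : 'End(V)) u, R (d u)} ->
  {in actv D U, forall v, R v}.
Proof.
move=> R0 RP RDU _ /memv_sumP[w Ww ->]; elim/big_rec: _ => // i v _ Rv.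
rewrite -[w i]scale1r; apply: RP => //.
by have /memv_imgP[u Uu ->] := Ww i isT; apply: RDU => //; apply: vbasis_nth.
Qed.

Lemma actv_subP D U W :
  reflect {in D & U, forall (d : 'End(V)) u, d u \in W} (actv D U <= W)%VS.
Proof.
apply: (iffP subvP) => [sDU d u Dd Uu|DUW]; first exact/sDU/memv_actv.
by apply: actv_ind => // [|a u v Wu Wv]; rewrite ?mem0v // memvD // memvZ.
Qed.

Lemma actvS D U W : (U <= W)%VS -> (actv D U <= actv D W)%VS.
Proof. by move=> UW; apply/actv_subP => d u Dd /(subvP UW);
  apply: memv_actv. Qed.

Definition act_word c (v : V) : V := foldr (fun (f : 'End(V)) w => f w) v c.
Arguments act_word : simpl never.

Lemma act_word_linear c : linear (act_word c).
Proof.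
elim: c => [|f c IH] a u v //; rewrite -[LHS]/(f (act_word c _)) IH linearP.
by [].
Qed.

HB.instance Definition _ c :=
  GRing.isLinear.Build K V V *:%R (act_word c) (act_word_linear c).

Lemma act_word_cat c c' v : act_word (c ++ c') v = act_word c (act_word c' v).
Proof. exact: foldr_cat. Qed.

Lemma act_word_rcons c f v : act_word (rcons c f) v = act_word c (f v).
Proof. exact: foldr_rcons. Qed.

(** Writing [f] as a sum of brackets [g h - h g] of elements of [P] lengthens the word by one
    letter; repeating this makes the words as long as required. *)
Lemma perfect_word_stable P (Y : {vspace V}) v k : lieV P P = P ->
    (forall c, all (mem P) c -> (k <= size c)%N -> act_word c v \in Y) ->
  {in P, forall f : 'End(V), f v \in Y}.
Proof.
move=> PP wordY.
suff gen j f : f \in P -> forall c, all (mem P) c -> (k <= size c + j)%N ->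
    f (act_word c v) \in Y.
  by move=> f Pf; apply: (gen k f Pf [::]).
elim: j f => [|j IH] f Pf.
  move=> c Pc lek; apply: (wordY (f :: c)); first by rewrite /= Pf.
  by rewrite addn0 in lek; apply: leqW.
have {Pf} : f \in lieV P P by rewrite PP.
move: f; apply: lieV_ind => [c _ _|a f g IHf IHg c Pc lek|f g Pf Pg c Pc lek].
- by rewrite lfunE mem0v.
- by rewrite !lfun_simp memvD ?memvZ ?IHf ?IHg.
rewrite lie_lfunE; apply: memvB.
  by have := IH f Pf (g :: c); rewrite /= Pg addSnnS; apply.
by have := IH g Pg (f :: c); rewrite /= Pf addSnnS; apply.
Qed.

(** Nilpotency of the associative algebra, without unit, generated by [P]. *)
Definition words_vanish P k :=
  forall c v, all (mem P) c -> (k <= size c)%N -> act_word c v = 0.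

Lemma words_vanish_stable P :
    (forall W, actv P W = W -> W = 0%VS) -> exists k, words_vanish P k.
Proof.
move=> stab0; pose u k := iter k (actv P) fullv.
have [|k uk] := @vspace_chain_stable _ _ u.
  by elim=> [|k IH]; [apply: subvf | apply: actvS].
have {}uk : u k = 0%VS by apply: stab0.
exists k => c v Pc lek; rewrite -(cat_take_drop (size c - k) c) act_word_cat.
rewrite [act_word (drop _ _) _](_ : _ = 0) ?linear0 //.
have u_word d : all (mem P) d -> act_word d v \in u (size d).
  elim: d => [|f d IH] Pd; first exact: memvf.
  by case/andP: Pd => Pf /IH; apply: (memv_actv Pf).
have := u_word (drop (size c - k) c); rewrite size_drop subKn // uk memv0 => d0.
by apply/eqP/d0/allP => f /mem_drop cf; apply: (allP Pc).
Qed.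

Lemma words_vanish_actv P W k : words_vanish P k -> (W <= actv P W)%VS -> W =
  0%VS.
Proof.
move=> Pk WPW; apply/eqP; rewrite -subv0; apply/subvP => w Ww.
suff gen j c w' : all (mem P) c -> (k <= size c + j)%N -> w' \in W -> act_word
  c w' = 0.
  by rewrite memv0 -[w]/(act_word [::] w) (gen k).
elim: j c w' => [|j IH] c w' Pc lek; first by rewrite addn0 in lek; rewrite Pk.
move/(subvP WPW); move: w'; apply: actv_ind => [|a u v u0 v0|f u Pf Wu].
- exact: linear0.
- by rewrite linearP /= u0 v0 scaler0 addr0.
by rewrite -act_word_rcons; apply: IH;
  rewrite ?all_rcons ?size_rcons ?addSnnS /= ?Pf.
Qed.

(** If [W] is spanned by [Q W] and [x W], then, [Q W] being stable under [x], iteration gives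
    [W = Q W + x^N W = Q W], which is zero because words in [Q] vanish. *)
Lemma words_vanish_extend Q k (x : 'End(V)) N :
    words_vanish Q k -> (forall v, iter N x v = 0) ->
    {in Q, forall q, lie q x \in Q} ->
  exists k', words_vanish (Q + <[x]>)%VS k'.
Proof.
move=> Qk xN Qx; apply: words_vanish_stable => W;
  set Q' := (Q + <[x]>)%VS => Q'W.
have xQ' : x \in Q' by rewrite memvE addvSr.
have QQ' : {subset Q <= Q'} by apply/subvP; apply: addvSl.
have Q'_W : {in Q' & W, forall (f : 'End(V)) w, f w \in W}.
  by move=> f w Q'f Ww; rewrite -Q'W memv_actv.
apply: (words_vanish_actv Qk).
have xQW w : w \in actv Q W -> x w \in actv Q W.
  move: w; apply: actv_ind => [|a u v Wu Wv|q w Qq Ww].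
  - by rewrite linear0 mem0v.
  - by rewrite linearP memvD ?memvZ.
  rewrite -[x (q w)](subrK (q (x w))) -opprB -lie_lfunE.
  by rewrite memvD ?memvN ?memv_actv ?Qx ?Q'_W.
have step j w : w \in W -> exists2 w', w' \in W & w - iter j x w' \in actv Q W.
  elim: j w => [|j IH] w Ww; first by exists w; rewrite ?subrr ?mem0v.
  have [w1 Ww1 w1E] := IH w Ww.
  have : w1 \in actv Q' W by rewrite Q'W.
  have: {in actv Q' W, forall w2, exists2 w', w' \in W & w2 - x w' \in actv Q
    W}.
    apply: actv_ind => [|a u v [u' Wu' uE] [v' Wv' vE]|f u /memv_addP[q Qq [_
      /vlineP[a ->] ->]] Wu].
    - by exists 0; [apply: mem0v | rewrite (linear0 x) subrr mem0v].
    - exists (a *: u' + v'); first by rewrite memvD ?memvZ.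
      by rewrite linearP opprD addrACA -scalerBr memvD ?memvZ.
    exists (a *: u); first by rewrite memvZ.
    by rewrite !lfun_simp linearZ /= addrK memv_actv.
  move/[apply] => -[w2 Ww2 w2E]; exists w2 => //.
  rewrite -[w](subrK (iter j x w1)) -addrA; apply: memvD => //.
  have iterB u v : iter j x u - iter j x v = iter j x (u - v).
    by elim: j {IH w1E} => //= j <-; rewrite linearB.
  by rewrite iterSr iterB; elim: j {IH w1E iterB} => //= j; apply: xQW.
apply/subvP => w /(step N)[w' _]; by rewrite xN subr0.
Qed.

(** Starting from zero, a subalgebra [Q] of [P] whose long words vanish is enlarged by an element
    [x] of [P] outside [Q] that normalises [Q], until it is all of [P]. *)
Lemma engel P : (lieV P P <= P)%VS ->
    {in P, forall f : 'End(V), exists N, forall v, iter N f v = 0} ->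
  exists k, words_vanish P k.
Proof.
move=> PP Pnil.
suff ext n Q : (Q <= P)%VS -> (lieV Q Q <= Q)%VS -> (exists k, words_vanish Q
  k) ->
    (\dim P - \dim Q <= n)%N -> exists k, words_vanish P k.
  apply: (ext (\dim P) 0%VS) => //; rewrite ?sub0v ?leq_subr //.
    by apply/lieVP => f g; rewrite !memv0 => /eqP-> _; rewrite linear0l.
  exists 1 => -[|f c] v //= /andP[]; rewrite memv0 => /eqP-> _ _.
  by rewrite -[LHS]/((0 : 'End(V)) (act_word c v)) lfunE.
elim: n Q => [|n IH] Q QP QQ [k Qk] len.
  by exists k; have -> : P = Q by apply/eqP;
    rewrite eq_sym eqEdim QP -subn_eq0 -leqn0.
have [PQ | PQ] := boolP (P <= Q)%VS.
  by exists k; have -> : P = Q by apply/eqP; rewrite eqEsubv PQ.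
pose u i := iter i (lieV Q) P.
have uP i : (u i <= P)%VS.
  elim: i => //= i IHi; apply/lieVP => q f /(subvP QP) Pq /(subvP IHi) Pf.
  by apply: (subvP PP); apply: memv_lie.
(* An [i]-fold bracket with [Q] expands into products of a word, an element of [P] and a word, the
   two words having [i] letters together. For [i = k + k] one of them has at least [k] letters and
   vanishes. *)
have u_words i f : f \in u i -> forall c c' v, all (mem Q) c -> all (mem Q) c'
  ->
    (k + k <= size c + size c' + i)%N -> act_word c (f (act_word c' v)) = 0.
  elim: i f => [|i IHi] f.
    move=> _ c c' v Qc Qc'; rewrite addn0 => le2k.
    have [lek | ltk] := leqP k (size c); first by rewrite Qk.
    by rewrite (Qk c') ?linear0 //; lia.
  move: f; apply: lieV_ind => [c c' v *|a f g If Ig c c' v *|q f Qq uf c c' v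
    Qc Qc' le2k].
  - by rewrite lfunE linear0.
  - by rewrite !lfun_simp linearP /= If ?Ig ?scaler0 ?addr0.
  rewrite lie_lfunE linearB /= -act_word_rcons.
  have -> : act_word (rcons c q) (f (act_word c' v)) = 0.
    by apply: IHi; rewrite ?all_rcons ?size_rcons /= ?Qq //; lia.
  have -> : act_word c (f (act_word (q :: c') v)) = 0.
    by apply: IHi; rewrite /= ?Qq //; lia.
  exact: subrr.
have [i0 min_i0] : exists i, (u i <= Q)%VS.
  exists (k + k)%N; apply/subvP => f uf; suff -> : f = 0 by rewrite mem0v.
  apply/lfunP => v; rewrite lfunE /=.
  by apply: (u_words (k + k)%N f uf [::] [::]).
(* The last term of the chain not contained in [Q] is sent into [Q] by brackets with [Q]; it
   supplies the normalising element [x]. *)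
have [[|i] ui min_i] := ex_minnP (ex_intro (fun i => (u i <= Q)%VS) i0 min_i0).
  by rewrite ui in PQ.
have [x ux xQ] : exists2 x, x \in u i & x \notin Q.
  by apply/subvPn; apply/negP => /min_i; rewrite ltnn.
have Qx : {in Q, forall q, lie q x \in Q}.
  by move=> q Qq; apply: (subvP ui); apply: memv_lie.
have Px : x \in P by apply: (subvP (uP i)).
have [N xN] := Pnil x Px.
apply: (IH (Q + <[x]>)%VS).
- by rewrite subv_add QP -memvE.
- apply/lieVP => _ _ /memv_addP[q Qq [_ /vlineP[a ->] ->]] /memv_addP[q' Qq' [_
    /vlineP[b ->] ->]].
  apply: (subvP (addvSl _ _)).
  have -> : lie (q + a *: x) (q' + b *: x) = lie q q' + b *: lie q x - a *: lie
    q' x.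
    rewrite linearDl !linearDr /= !linearZl_LR !linearZr_LR /= liexx !scaler0
      addr0.
    by rewrite (lieC x q') scalerN.
  have QQq : lie q q' \in Q by apply/(subvP QQ)/memv_lie.
  by apply: memvB; [apply: memvD => //|]; apply/memvZ/Qx.
- exact: words_vanish_extend Qk xN Qx.
have: (\dim Q < \dim (Q + <[x]>))%N.
  rewrite ltnNge; apply: contra xQ => ledim.
  have /eqP-> : (Q == Q + <[x]>)%VS by rewrite eqEdim addvSl.
  by rewrite memvE addvSr.
have := dimvS QP; lia.
Qed.

(** The derived series becomes stationary at a perfect [P]. The trace criterion makes its elements
    nilpotent, Engel's theorem kills long words, and perfectness shortens these to single operators,
    so [P] is zero. *)
Theorem solvable_of_lftrace (charK : [pchar K] =i pred0) (J : {vspace 'End(V)})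
  :
    (lieV J J <= J)%VS -> {in J &, forall f g, lftrace (f \o g)%VF = 0} ->
  solvable J.
Proof.
move=> JJ tr0.
have derJ k : (derived_series J k.+1 <= derived_series J k)%VS.
  elim: k => //= k IH; apply/lieVP => f g /(subvP IH) Jf /(subvP IH) Jg.
  exact: memv_lie.
have [k] := vspace_chain_stable derJ; set P := derived_series J k => PP.
have PJ : (P <= J)%VS.
  by rewrite /P; elim: (k) => //= j; apply: subv_trans; apply: derJ.
have [||N PN] := @engel P; first by rewrite -[X in (_ <= X)%VS]PP subvv.
  apply: nilpotent_of_lftrace => // f g Pf Pg.
  by apply: tr0; apply: (subvP PJ).
exists k; apply/eqP; rewrite -subv0; apply/subvP => f Pf; rewrite memv0;
  apply/eqP/lfunP => v.
rewrite lfunE /=; apply/eqP; rewrite -memv0.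
apply: (perfect_word_stable PP (k := N)) => // c Pc /PN-> //.
by rewrite mem0v.
Qed.

End Action.

(** * Semisimple algebras of operators *)

Section DerivedSeries.
Variables (K : fieldType) (L : skewAlgType K).
Implicit Types U V I S : {vspace L}.

Lemma lieVS U U' V V' :
  (U <= U')%VS -> (V <= V')%VS -> (lieV U V <= lieV U' V')%VS.
Proof.
move=> UU VV; apply/lieVP => u v /(subvP UU) Uu /(subvP VV) Vv.
exact: memv_lie.
Qed.

Lemma derived_series_sub U k : subalgebra U -> (derived_series U k <= U)%VS.
Proof.
move=> subU; elim: k => //= k IH; apply: subv_trans subU; exact: lieVS.
Qed.

Lemma ideal_subalgebra I S : ideal_of I S -> subalgebra I.
Proof. by case=> IS SI; apply: subv_trans SI; apply: lieVS. Qed.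

End DerivedSeries.

Section MorphismImage.
Variables (K : fieldType) (A B : skewAlgType K) (h : 'Hom(A, B)) (S : {vspace
  A}).
Hypothesis hS : {in S &, forall x y, h (lie x y) = lie (h x) (h y)}.

Lemma limg_lieV (U V : {vspace A}) : (U <= S)%VS -> (V <= S)%VS ->
  (h @: lieV U V = lieV (h @: U) (h @: V))%VS.
Proof.
move=> US VS; apply/eqP; rewrite eqEsubv; apply/andP; split; last first.
  apply/lieVP => _ _ /memv_imgP[u Uu ->] /memv_imgP[v Vv ->].
  by rewrite -hS ?memv_img ?memv_lie ?(subvP US u) ?(subvP VS v).
apply/subvP => _ /memv_imgP[w wUV ->]; move: w wUV.
apply: lieV_ind => [|a u v hu hv|u v Uu Vv]; first by rewrite linear0 mem0v.
  by rewrite linearP memvD ?memvZ.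
by rewrite hS ?memv_lie ?memv_img ?(subvP US u) ?(subvP VS v).
Qed.

Lemma limg_derived_series (U : {vspace A}) k : (U <= S)%VS -> subalgebra U ->
  (h @: derived_series U k = derived_series (h @: U) k)%VS.
Proof.
move=> US subU; have derS j : (derived_series U j <= S)%VS.
  exact: subv_trans (derived_series_sub _ subU) US.
by elim: k => //= k <-; rewrite limg_lieV ?derS.
Qed.

Lemma limg_subalgebra (U : {vspace A}) :
  (U <= S)%VS -> subalgebra U -> subalgebra (h @: U)%VS.
Proof. by move=> US subU; rewrite /subalgebra -limg_lieV // limgS. Qed.

(** A solvable ideal of the image is pulled back inside [S], where [h] is an injective morphism; a
    vanishing derived term upstairs follows from the one downstairs. *)
Lemma limg_semisimple : semisimple S -> (S :&: lker h = 0)%VS ->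
  semisimple (h @: S)%VS.
Proof.
move=> [subS ssS] injh; split=> [|I [IhS hSI] [k Ik]];
  first exact: limg_subalgebra.
pose I' := (S :&: h @^-1: I)%VS.
have hI' : (h @: I')%VS = I.
  apply/eqP; rewrite eqEsubv; apply/andP; split; apply/subvP => y.
    by case/memv_imgP=> x; rewrite memv_cap -memv_preim => /andP[_ hx] ->.
  move=> Iy; have /memv_imgP[x Sx Ey] := subvP IhS y Iy.
  by rewrite Ey memv_img // memv_cap Sx -memv_preim -Ey.
have I'S : (I' <= S)%VS by apply: capvSl.
have idI' : ideal_of I' S.
  split=> //; apply/lieVP => s x Ss;
    rewrite memv_cap -memv_preim => /andP[Sx hx].
  rewrite memv_cap (subvP subS) ?memv_lie // -memv_preim hS //.
  by apply: (subvP hSI); rewrite memv_lie ?memv_img.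
have subI' := ideal_subalgebra idI'.
suff I'0 : I' = 0%VS by rewrite -hI' I'0 limg0.
apply: ssS => //; exists k; apply/eqP; rewrite -subv0 -injh subv_cap.
rewrite (subv_trans (derived_series_sub _ subI')) //=.
by rewrite lkerE limg_derived_series // hI' Ik.
Qed.

End MorphismImage.

(** * Restriction to a subspace and its trace form *)

Section Restriction.
Variables (K : fieldType) (V : vectType K) (W : {vspace V}).
Implicit Types f g : 'End(V).

(** Projecting back to [W] makes this linear in every [f]; it is the restriction of [f] when [f]
    stabilises [W]. *)
Definition res_lfun f : 'End(subvs_of W) :=
  (linfun (vsproj W) \o f \o linfun (@vsval _ _ W))%VF.

Lemma res_lfun_linear : linear res_lfun.
Proof.
by move=> a f g; rewrite /res_lfun comp_lfunDr comp_lfunDl -comp_lfunZr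
  -comp_lfunZl.
Qed.

HB.instance Definition _ :=
  GRing.isLinear.Build K 'End(V) 'End(subvs_of W) *:%R res_lfun res_lfun_linear.

Definition stabilises f := (f @: W <= W)%VS.

Lemma stabilisesP f : reflect {in W, forall w, f w \in W} (stabilises f).
Proof.
apply: (iffP subvP) => [fW w Ww | fW _ /memv_imgP[w Ww ->]]; last exact: fW.
by apply: fW; apply: memv_img.
Qed.

Lemma res_lfunE f w : stabilises f -> vsval (res_lfun f w) = f (vsval w).
Proof. by move/stabilisesP=> fW;
  rewrite !lfun_simp vsprojK // fW // subvsP. Qed.

Lemma res_lfun_comp f g : stabilises g ->
  res_lfun (f \o g)%VF = (res_lfun f \o res_lfun g)%VF.
Proof. 
move=> gW; apply/lfunP => w; rewrite !lfun_simp /= vsprojK //.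
exact: (stabilisesP _ gW _ (subvsP w)).
Qed.

Lemma res_lfun_lie f g : stabilises f -> stabilises g ->
  res_lfun (lie f g) = lie (res_lfun f) (res_lfun g).
Proof. by move=> fW gW; rewrite [LHS]linearB /= !res_lfun_comp. Qed.

Definition trform f g : K := lftrace (res_lfun (f \o g)%VF).

Lemma trform_bilinear : bilinear_for *%R *%R trform.
Proof.
split=> f a g h; rewrite /trform ?comp_lfunDl ?comp_lfunDr -?comp_lfunZl
  -?comp_lfunZr.
  by rewrite !linearP.
by rewrite !linearP.
Qed.

HB.instance Definition _ :=
  bilinear_isBilinear.Build K 'End(V) 'End(V) K *%R *%R trform trform_bilinear.

Lemma trformC f g : stabilises f -> stabilises g -> trform f g = trform g f.
Proof. by move=> fW gW; rewrite /trform !res_lfun_comp // lftraceC. Qed.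

Lemma stabilises_comp f g : stabilises f -> stabilises g -> stabilises (f \o
  g)%VF.
Proof.
move=> /stabilisesP fW /stabilisesP gW; apply/stabilisesP => w Ww.
by rewrite lfunE /=; apply/fW/gW.
Qed.

Lemma trform_inv f g h : stabilises f -> stabilises g -> stabilises h ->
  trform (lie f g) h = trform f (lie g h).
Proof.
move=> fW gW hW.
have -> : trform (lie f g) h = trform (f \o g)%VF h - trform (g \o f)%VF h.
  by rewrite -linearBl.
have -> : trform f (lie g h) = trform f (g \o h)%VF - trform f (h \o g)%VF.
  by rewrite -linearBr.
rewrite [trform (g \o f)%VF h]/trform -comp_lfunA -/(trform g _).
rewrite [X in _ - X]trformC ?stabilises_comp //.
by rewrite /trform !comp_lfunA.
Qed.

End Restriction.

Section TraceForm.
Variables (K : fieldType) (charK : [pchar K] =i pred0) (V : vectType K).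
Variables (S : {vspace 'End(V)}) (W : {vspace V}).
Hypotheses (subS : subalgebra S) (SW : {in S, forall f, stabilises W f}).
Implicit Types (I M : {vspace 'End(V)}) (f g : 'End(V)).
Local Notation B := (trform W).

(** Cartan's criterion applied to the restriction of [I] to [W]: a derived term vanishing after
    restriction is one that acts as zero on [W]. *)
Lemma isotropic_derived_series I : ideal_of I S -> {in I &, forall f g, B f g =
  0} ->
  exists k, {in derived_series I k & W, forall f w, f w = 0}.
Proof.
move=> idI B0; have subI := ideal_subalgebra idI.
pose r : 'Hom('End(V), 'End(subvs_of W)) := linfun (res_lfun W).
have IS f : f \in I -> f \in S by apply: (subvP idI.1).
have rI : {in I &, forall f g, r (lie f g) = lie (r f) (r g)}.
  by move=> f g If Ig; rewrite !lfunE /= res_lfun_lie ?SW ?IS.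
have [||k rk] := @solvable_of_lftrace K _ charK (r @: I)%VS.
- by apply: (limg_subalgebra rI).
- move=> _ _ /memv_imgP[f If ->] /memv_imgP[g Ig ->].
  by rewrite !lfunE /= -res_lfun_comp ?SW ?IS // -/(B f g) B0.
exists k => f w fk Ww.
have : r f \in (r @: derived_series I k)%VS by rewrite memv_img.
rewrite (limg_derived_series rI) // rk memv0 lfunE /= => /eqP rf.
have fI := subvP (derived_series_sub k subI) f fk.
by rewrite -(vsprojK Ww) -res_lfunE ?SW ?IS // rf lfunE.
Qed.

Definition perp I : {vspace 'End(V)} :=
  (S :&: solv1 I (fun f g => B f g : K^o))%VS.

Lemma perpP I f :
  reflect (f \in S /\ {in I, forall g, B f g = 0}) (f \in perp I).
Proof.
rewrite memv_cap; apply: (iffP andP) => -[Sf If]; split=> //.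
  by apply/(solv1P _ _ _ _): If => [g a f1 f2|f1 a g1 g2];
    rewrite ?linearPl ?linearPr.
by apply/solv1P => // [g a f1 f2|f1 a g1 g2]; rewrite ?linearPl ?linearPr.
Qed.

Lemma perp_ideal I : ideal_of I S -> ideal_of (perp I) S.
Proof.
move=> [IS SI]; split; first exact: capvSl.
apply/lieVP => s f Ss /perpP[Sf If]; apply/perpP; split.
  by apply: (subvP subS); apply: memv_lie.
move=> g Ig; have Sg := subvP IS g Ig.
rewrite lieC linearNl /= trform_inv ?SW // If ?oppr0 //.
by apply: (subvP SI); apply: memv_lie.
Qed.

Definition nondegenerate M :=
  {in M, forall f, {in M, forall g, B f g = 0} -> f = 0}.

Definition gram M : 'M[K]_(\dim M) := \matrix_(i, j) B (vbasis M)`_i (vbasis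
  M)`_j.

Lemma gram_unit M : nondegenerate M -> gram M \in unitmx.
Proof.
move=> ndM; rewrite -row_free_unit -kermx_eq0; apply/eqP/row_matrixP => i;
  rewrite row0.
have /eqP : row i (kermx (gram M)) *m gram M = 0 by rewrite -row_mul mulmx_ker
  row0.
move: (row i _) => v /eqP vG.
pose f := \sum_j v 0 j *: (vbasis M)`_j.
have Mf : f \in M by apply: memv_suml => j _; rewrite memvZ ?vbasis_nth.
have f0 : f = 0.
  apply: ndM => // g /coord_vbasis->; rewrite linear_sumr big1 // => j _.
  rewrite linearZr_LR /= [B f _](_ : _ = (v *m gram M) 0 j).
    by rewrite vG mxE mulr0.
  by rewrite linear_sumlz mxE; apply: eq_bigr => l _; rewrite mxE linearZl_LR.
apply/rowP => j; rewrite mxE.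
by have := coord_sum_free (fun l => v 0 l) j (basis_free (vbasisP M));
  rewrite -/f f0 linear0.
Qed.

Lemma perp_decomposition I f : (I <= S)%VS -> nondegenerate I -> f \in S ->
  exists2 g, g \in I & f - g \in perp I.
Proof.
move=> IS ndI Sf.
have [c cG] : exists c, c *m gram I = \row_j B f (vbasis I)`_j.
  by eexists; apply: mulmxKV; apply: gram_unit.
pose g := \sum_j c 0 j *: (vbasis I)`_j.
have Ig : g \in I by apply: memv_suml => j _; rewrite memvZ ?vbasis_nth.
exists g => //; apply/perpP; split; first by rewrite memvB ?(subvP IS g).
move=> h /coord_vbasis->; rewrite linear_sumr big1 // => j _.
rewrite linearZr_LR /= linearBl /= [B g _](_ : _ = (c *m gram I) 0 j).
  by rewrite cG mxE subrr mulr0.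
by rewrite linear_sumlz mxE; apply: eq_bigr => l _;
  rewrite [in RHS]mxE linearZl_LR.
Qed.

End TraceForm.

Section Semisimple.
Variables (K : fieldType) (charK : [pchar K] =i pred0) (V : vectType K).
Variables (S : {vspace 'End(V)}) (ssS : semisimple S).
Implicit Types (I M : {vspace 'End(V)}) (f g : 'End(V)).

Let subS : subalgebra S := ssS.1.

Let S_full : {in S, forall f, stabilises {:V} f}.
Proof. by move=> f _; apply: subvf. Qed.

Local Notation B := (trform {:V}).

Lemma ideal_cap I M : ideal_of I S -> ideal_of M S -> ideal_of (I :&: M)%VS S.
Proof.
move=> [IS SI] [MS SM]; split; first exact: subv_trans (capvSl _ _) IS.
rewrite subv_cap (subv_trans (lieVS (subvv _) (capvSl _ _)) SI).
exact: subv_trans (lieVS (subvv _) (capvSr _ _)) SM.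
Qed.

Lemma semisimple_isotropic I :
  ideal_of I S -> {in I &, forall f g, B f g = 0} -> I = 0%VS.
Proof.
move=> idI B0; apply: ssS.2 => //.
have [k Ik] := isotropic_derived_series charK S_full idI B0.
exists k; apply/eqP; rewrite -subv0; apply/subvP => f fk; rewrite memv0;
  apply/eqP/lfunP => v.
by rewrite Ik ?memvf // lfunE.
Qed.

(** The intersection of [I] with its orthogonal is an isotropic ideal, hence zero. *)
Lemma semisimple_nondegenerate I : ideal_of I S -> nondegenerate {:V} I.
Proof.
move=> idI f If f0.
have := semisimple_isotropic (ideal_cap idI (perp_ideal subS S_full idI)).
move=> I0; apply/eqP; rewrite -memv0 -I0; last first.
  by move=> g h /memv_capP[_ /perpP[_ gI]] /memv_capP[Ih _]; apply: gI.
by rewrite memv_cap If; apply/perpP; split=> //; apply: (subvP idI.1).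
Qed.

(** By invariance of the trace form, the orthogonal of [[S, S]] is an abelian ideal, hence zero,
    while [S] is spanned by [[S, S]] and this orthogonal. *)
Lemma semisimple_perfect : lieV S S = S.
Proof.
have idS : ideal_of S S by split; rewrite ?subvv.
have idI : ideal_of (lieV S S) S by split=> //; apply: lieVS.
have ndS := semisimple_nondegenerate idS.
have idP := perp_ideal subS S_full idI.
have P0 : perp S {:V} (lieV S S) = 0%VS.
  apply: ssS.2 => //; exists 1; apply/eqP; rewrite -subv0; apply/lieVP => f g.
  move=> /perpP[Sf If] /perpP[Sg Ig]; rewrite memv0; apply/eqP/ndS => [|h Sh].
    by apply: (subvP subS); apply: memv_lie.
  by rewrite trform_inv ?S_full // If // memv_lie.
apply/eqP; rewrite eqEsubv subS; apply/subvP => f Sf.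
have [g Ig] := perp_decomposition subS (semisimple_nondegenerate idI) Sf.
by rewrite P0 memv0 subr_eq0 => /eqP->.
Qed.

(** * The Casimir operator of a representation *)

Section Casimir.
Variable W : {vspace V}.
Hypothesis SW : {in S, forall f, stabilises W f}.

Let SWE f w : f \in S -> w \in W -> f w \in W.
Proof. by move=> /SW/stabilisesP; apply. Qed.

Let kerW : {vspace 'End(V)} := (S :&: solv1 W (fun (f : 'End(V)) w => f w))%VS.

Let kerWP f : reflect (f \in S /\ {in W, forall w, f w = 0}) (f \in kerW).
Proof.
rewrite memv_cap; apply: (iffP andP) => -[Sf fW]; split=> //.
  by apply/(solv1P _ _ _ _): fW => [w a g h|g a u v];
    rewrite ?lfun_simp ?linearP.
by apply/solv1P => // [w a g h|g a u v]; rewrite ?lfun_simp ?linearP.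
Qed.

Let kerW_ideal : ideal_of kerW S.
Proof.
split; first exact: capvSl.
apply/lieVP => s f Ss /kerWP[Sf fW]; apply/kerWP; split.
  by apply: (subvP subS); apply: memv_lie.
by move=> w Ww; rewrite lie_lfunE (fW w) // (fW (s w)) ?SWE // linear0 subrr.
Qed.

(* M acts on W with a nondegenerate trace form, and kerW + M = S. *)
Let M := perp S {:V} kerW.

Let M_ideal : ideal_of M S. Proof. exact: perp_ideal. Qed.

Let MS f : f \in M -> f \in S. Proof. exact: (subvP M_ideal.1). Qed.

(** By Cartan's criterion a derived term of the radical [R] of the form on [M] acts as zero on [W].
    It then lies in [kerW] and is orthogonal to it, so it vanishes and [R] is solvable. *)
Let M_nondegenerate : nondegenerate W M.
Proof.
pose R := (M :&: perp S W M)%VS.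
have idR : ideal_of R S by apply: ideal_cap => //; apply: perp_ideal.
suff R0 : R = 0%VS.
  move=> f Mf f0; apply/eqP; rewrite -memv0 -R0 memv_cap Mf.
  by apply/perpP; split=> //; apply: MS.
have [|k Rk] := isotropic_derived_series charK SW idR.
  by move=> f g /memv_capP[_ /perpP[_ fM]] /memv_capP[Mg _]; apply: fM.
apply: ssS.2 => //; exists k; apply/eqP; rewrite -subv0; apply/subvP => f fk.
have : f \in R by apply: subvP fk;
  apply: derived_series_sub (ideal_subalgebra idR).
case/memv_capP=> /perpP[Sf fker] _.
have kf : f \in kerW by apply/kerWP; split=> // w; apply: Rk.
rewrite memv0; apply/eqP/(semisimple_nondegenerate kerW_ideal) => //.
Qed.

Let G := gram W M.
Let H := invmx G.
Let e (i : 'I_(\dim M)) := (vbasis M)`_i.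

Let eM i : e i \in M. Proof. exact: vbasis_nth. Qed.

(** The Casimir element of [M] for the trace form of [W]: the inverse Gram matrix [H] passes from
    [e] to the dual basis. *)
Let C : 'End(V) := \sum_i \sum_j H i j *: (e i \o e j)%VF.

Let CE v : C v = \sum_i \sum_j H i j *: e i (e j v).
Proof.
rewrite sum_lfunE; apply: eq_bigr => i _; rewrite sum_lfunE;
  apply: eq_bigr => j _.
by rewrite !lfun_simp.
Qed.

(** With [A] the matrix of [ad f] on [M], invariance of the form reads [A G + G A^T = 0].
    Multiplying by [H] on both sides gives [H A + A^T H = 0], whose entries are the coefficients of
    the commutator of [f] and [C]. *)
Let C_M f v : f \in M -> f (C v) = C (f v).
Proof.
move=> Mf; have MSf := MS Mf.
pose A := \matrix_(i, k) coord (vbasis M) k (lie f (e i)).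
have AE i : lie f (e i) = \sum_k A i k *: e k.
  have : lie f (e i) \in M by apply: (subvP M_ideal.2); rewrite memv_lie ?eM.
  by move/coord_vbasis => {1}->; apply: eq_bigr => k _; rewrite mxE.
have AG : A *m G + G *m A^T = 0.
  apply/matrixP => i j; rewrite !mxE.
  have inv0 : trform W (lie f (e i)) (e j) + trform W (e i) (lie f (e j)) = 0.
    rewrite (lieC f (e i)) linearNl /= trform_inv ?SW ?MS ?eM //.
    by rewrite addNr.
  apply: etrans inv0; congr (_ + _).
    rewrite AE linear_sumlz; apply: eq_bigr => k _.
    by rewrite linearZl_LR [X in _ * X = _]mxE.
  rewrite AE linear_sumr; apply: eq_bigr => k _.
  by rewrite linearZr_LR [X in X * _ = _]mxE [X in _ * X = _]mxE mulrC.
have unitG : G \in unitmx by apply: gram_unit.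
have HA : H *m A + A^T *m H = 0.
  have : H *m (A *m G + G *m A^T) *m H = 0 by rewrite AG mulmx0 mul0mx.
  by rewrite mulmxDr mulmxDl !mulmxA mulVmx // mul1mx -!mulmxA mulmxV // mulmx1.
have fe i w : f (e i w) = e i (f w) + \sum_k A i k *: e k w.
  rewrite -[LHS](subrK (e i (f w))) -lie_lfunE addrC AE sum_lfunE;
    congr (_ + _).
  by apply: eq_bigr => k _; rewrite lfunE.
have fC : f (C v) = C (f v)
    + \sum_i \sum_j H i j *: (\sum_k A j k *: e i (e k v))
    + \sum_i \sum_j H i j *: (\sum_k A i k *: e k (e j v)).
  rewrite !CE linear_sum -!big_split; apply: eq_bigr => i _ /=.
  rewrite linear_sum -!big_split; apply: eq_bigr => j _ /=.
  rewrite linearZ /= !fe (linearD (e i)) (linear_sum (e i)) !scalerDr;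
    congr (_ + _ *: _ + _).
  by apply: eq_bigr => k _; rewrite linearZ.
rewrite fC -addrA -[RHS]addr0; congr (_ + _).
transitivity (\sum_i \sum_k (H *m A + A^T *m H) i k *: e i (e k v)); last first.
  by rewrite HA big1 // => i _; rewrite big1 // => k _; rewrite mxE scale0r.
under [RHS]eq_bigr do under eq_bigr do rewrite mxE scalerDl.
under [RHS]eq_bigr do rewrite big_split; rewrite big_split; congr (_ + _).
  apply: eq_bigr => i _; under [LHS]eq_bigr do rewrite scaler_sumr.
  rewrite exchange_big; apply: eq_bigr => k _; rewrite [in RHS]mxE scaler_suml.
  by apply: eq_bigr => j _; rewrite scalerA.
rewrite [LHS]exchange_big /= [RHS]exchange_big; apply: eq_bigr => j _ /=.
under [LHS]eq_bigr do rewrite scaler_sumr; rewrite exchange_big;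
  apply: eq_bigr => k _.
rewrite [in RHS]mxE scaler_suml; apply: eq_bigr => i _.
by rewrite scalerA [X in _ = (X * _) *: _]mxE mulrC.
Qed.

Let trC : lftrace (res_lfun W C) = (\dim M)%:R.
Proof.
have unitG : G \in unitmx by apply: gram_unit.
have <- : \tr (H *m G) = (\dim M)%:R by rewrite mulVmx // mxtrace1.
have -> : lftrace (res_lfun W C) = \sum_i \sum_j H i j * trform W (e i) (e j).
  pose t f := lftrace (res_lfun W f).
  have tP a f g : t (a *: f + g) = a * t f + t g by rewrite /t res_lfun_linear
    lftrace_linear.
  have t0 : t 0 = 0 by have := tP (-1) 0 0; rewrite scaler0 addr0 mulN1r addNr.
  have tD f g : t (f + g) = t f + t g by rewrite -[f in LHS]scale1r tP mul1r.
  rewrite -/(t C) /C (big_morph t tD t0); apply: eq_bigr => i _.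
  rewrite (big_morph t tD t0); apply: eq_bigr => j _.
  by rewrite -[_ *: _]addr0 tP t0 addr0.
apply: eq_bigr => i _; rewrite [RHS]mxE.
apply: eq_bigr => j _; rewrite trformC ?SW ?MS ?eM //.
by rewrite [G _ _]mxE.
Qed.

(** Commutation passes from [M] to [S] because [kerW] acts as zero on [W]. If [C] is nilpotent on
    [W], its trace [\dim M] vanishes, so in characteristic zero [M] is zero and [S] is [kerW]. *)
Lemma casimir : exists C' : 'End(V),
  [/\ {in W, forall w, C' w \in actv S W},
      {in S & W, forall f w, f (C' w) = C' (f w)},
      {in W, forall w, {in S, forall f : 'End(V), f w = 0} -> C' w = 0}
    & (exists N, {in W, forall w, iter N C' w = 0}) ->
      {in S & W, forall f w, f w = 0}].
Proof.
have eW i w : w \in W -> e i w \in W by move=> Ww; apply: SWE => //;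
  apply/MS/eM.
have CW w : w \in W -> C w \in W.
  move=> Ww; rewrite CE memv_suml // => i _; rewrite memv_suml // => j _.
  by rewrite memvZ // !eW.
exists C; split.
- move=> w Ww; rewrite CE memv_suml // => i _; rewrite memv_suml // => j _.
  by rewrite memvZ // memv_actv ?eW //; apply/MS/eM.
- move=> f w Sf Ww.
  have [g kg] := perp_decomposition kerW_ideal.1 (semisimple_nondegenerate
    kerW_ideal) Sf.
  rewrite -/M => /(C_M w).
  have /kerWP[_ g0] := kg.
  by rewrite ![(f - g) _]add_lfunE ![(- g) _]opp_lfunE (g0 w) // (g0 (C w)) ?CW
    // !subr0.
- move=> w Ww w0; rewrite CE big1 // => i _; rewrite big1 // => j _.
  by rewrite (w0 (e j)) ?linear0 ?scaler0 //; apply/MS/eM.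
case=> N CN.
have stC : stabilises W C by apply/stabilisesP.
have dimM0 : \dim M = 0%N.
  apply/eqP; rewrite -((pcharf0P K).1 charK) -trC;
    apply/eqP/(@lftrace_nilpotent _ _ _ N) => w.
  apply: (@subvs_inj _ _ W); rewrite -[RHS](CN _ (subvsP w)).
  by elim: (N) => //= j <-; rewrite res_lfunE.
have M0 : M = 0%VS by apply/eqP; rewrite -dimv_eq0 dimM0.
move=> f w Sf Ww.
have [g kg] := perp_decomposition kerW_ideal.1 (semisimple_nondegenerate
  kerW_ideal) Sf.
rewrite -/M M0 memv0 subr_eq0 => /eqP->.
by have /kerWP[_ ->] := kg.
Qed.

End Casimir.
(** Fitting decomposition of [W] under the Casimir operator: it is bijective on [W1], which
    therefore lies in [actv S W], and nilpotent on [W0]. Either [W0] is all of [W] and [S] acts as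
    zero, or induction applies to [W0]. *)
Theorem semisimple_splitting (W : {vspace V}) : {in S, forall f, stabilises W
  f} ->
  {in W, forall w, exists u v, [/\ w = u + v, u \in actv S W, v \in W
                             & {in S, forall f : 'End(V), f v = 0}]}
  /\ {in actv S W, forall w, {in S, forall f : 'End(V), f w = 0} -> w = 0}.
Proof.
have [d] := ubnP (\dim W); elim: d W => // d IH W leWd SW.
have SWE f w : f \in S -> w \in W -> f w \in W.
  by move=> /SW/stabilisesP; apply.
have [C [CS CC C0 Cnil]] := casimir SW.
have SW_W : (actv S W <= W)%VS by apply/actv_subP => f w; apply: SWE.
have CW w : w \in W -> C w \in W by move/CS/(subvP SW_W).
pose c k := iter k (comp_lfun C) \1%VF.
have cE k w : c k w = iter k C w.
  by elim: k => [|k IHk]; rewrite /= ?id_lfunE // comp_lfunE -IHk.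
have cW k w : w \in W -> c k w \in W.
  by move=> Ww; rewrite cE; elim: k => //= k; apply: CW.
have Sc k f w : f \in S -> w \in W -> f (c k w) = c k (f w).
  move=> Sf Ww; rewrite !cE; elim: k => //= k <-.
  by rewrite CC // -cE cW.
have c_im k : (c k.+1 @: W = C @: (c k @: W))%VS by rewrite -limg_comp.
have [|N cN] := @vspace_chain_stable _ _ (fun k => c k @: W)%VS.
  move=> k; apply/subvP => _ /memv_imgP[w Ww ->].
  by rewrite cE iterSr -cE memv_img // CW.
set W1 := (c N @: W)%VS in cN; pose W0 := (W :&: lker (c N))%VS.
have CW1 : (C @: W1)%VS = W1 by rewrite -c_im cN.
have W1W : (W1 <= W)%VS by apply/subvP => _ /memv_imgP[w Ww ->]; apply: cW.
have Cinj w : w \in W1 -> C w = 0 -> w = 0.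
  move=> W1w Cw; apply/eqP; rewrite -memv0.
  have /eqP <- : (W1 :&: lker C == 0)%VS.
    have := limg_ker_dim C W1; rewrite CW1 -dimv_eq0 => /eqP.
    by rewrite -[X in _ == X]add0n eqn_add2r.
  by rewrite memv_cap W1w memv_ker Cw eqxx.
have CW1in w : w \in W1 -> C w \in W1 by rewrite -[in X in _ -> X]CW1;
  apply: memv_img.
have W01 w : w \in W0 -> w \in W1 -> w = 0.
  rewrite memv_cap memv_ker cE => /andP[_ /eqP wN].
  elim: (N) w wN => //= k IHk w; rewrite -iterS iterSr => /IHk Cw W1w.
  by apply: Cinj => //; apply: Cw; apply: CW1in.
have SW1 f w : f \in S -> w \in W1 -> f w \in W1.
  by move=> Sf /memv_imgP[v Wv ->]; rewrite Sc // memv_img // SWE.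
have SW0 f w : f \in S -> w \in W0 -> f w \in W0.
  move=> Sf; rewrite !memv_cap !memv_ker => /andP[Ww /eqP w0].
  by rewrite SWE // -Sc // w0 linear0 eqxx.
have split01 w : w \in W -> exists2 w1, w1 \in W1 & w - w1 \in W0.
  move=> Ww; have cNW1 k : (c k @: W1)%VS = W1.
    by elim: k => [|k IHk]; rewrite ?lim1g // limg_comp IHk.
  have /memv_imgP[w1 W1w1 E] : c N w \in (c N @: W1)%VS by rewrite cNW1
    memv_img.
  exists w1 => //; rewrite memv_cap memvB //; last exact: (subvP W1W).
  by rewrite memv_ker linearB /= E subrr.
have [W0W | W0W] := eqVneq W0 W.
  have S0 : {in S & W, forall f w, f w = 0}.
    apply: Cnil; exists N => w;
      rewrite -W0W memv_cap memv_ker cE => /andP[_ /eqP].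
    by [].
  split=> [w Ww|w].
    by exists 0, w; rewrite add0r mem0v; split=> // f Sf; apply: S0.
  have -> : actv S W = 0%VS.
    apply/eqP; rewrite -subv0; apply/actv_subP => f u Sf Wu.
    by rewrite S0 ?mem0v.
  by rewrite memv0 => /eqP.
have [||IHa IHb] := IH W0.
- rewrite -ltnS; apply: leq_trans leWd; rewrite ltnS ltnNge.
  by apply: contra W0W => leW; rewrite eqEdim capvSl.
- by move=> f Sf; apply/stabilisesP => w; apply: SW0.
split=> [w Ww|w Sw w0].
  have [w1 W1w1 /IHa[u [v [E Su W0v v0]]]] := split01 w Ww.
  exists (w1 + u), v; split=> //; last by apply: (subvP (capvSl _ _)) W0v.
    by rewrite -addrA -E addrC subrK.
  rewrite memvD ?(subvP (actvS _ (capvSl _ _)) _ Su) //.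
  by move: W1w1; rewrite -CW1 => /memv_imgP[w2 W1w2 ->]; apply/CS/(subvP W1W).
have [w1 W1w1 Sw0] : exists2 w1, w1 \in W1 & w - w1 \in actv S W0.
  move: w Sw {w0}; apply: actv_ind => [|a u v [u1 W1u Eu] [v1 W1v Ev]|f u Sf
    Wu].
  - by exists 0; rewrite ?subrr mem0v.
  - exists (a *: u1 + v1); first by rewrite memvD ?memvZ.
    by rewrite opprD addrACA -scalerBr memvD ?memvZ.
  have [u1 W1u Eu] := split01 u Wu.
  by exists (f u1); rewrite ?SW1 // -linearB memv_actv.
have SW0W0 : (actv S W0 <= W0)%VS by apply/actv_subP => f u; apply: SW0.
have Ww : w \in W by apply: (subvP SW_W).
(* [C] kills the fixed vector [w], so [C (w - w1) = - C w1] lies in both [W0] and [W1]. *)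
have w10 : w1 = 0.
  apply: Cinj => //; apply: W01; last exact: CW1in.
  have CSw0 : c N (C (w - w1)) = 0.
    rewrite cE -iterSr iterS -cE.
    have := subvP SW0W0 _ Sw0; rewrite memv_cap memv_ker => /andP[_ /eqP->].
    exact: linear0.
  rewrite memv_cap memv_ker CW ?(subvP W1W) //=.
  have CE1 : C (w - w1) = - C w1 by rewrite (linearB C) /= (C0 w Ww w0) sub0r.
  by move: CSw0; rewrite CE1 linearN => /eqP; rewrite oppr_eq0.
by move: Sw0; rewrite w10 subr0 => /IHb->.
Qed.

End Semisimple.

(** * Derivations of L_n(n, z0) *)

Section Adjoint.
Variables (K : fieldType) (L : skewAlgType K).

Definition ad_fun (a u : L) : L := lie a u.

Lemma ad_fun_linear a : linear (ad_fun a).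
Proof. by move=> c u v; rewrite /ad_fun linearPr. Qed.

HB.instance Definition _ a :=
  GRing.isLinear.Build K L L *:%R (ad_fun a) (ad_fun_linear a).

Definition ad a : 'End(L) := linfun (ad_fun a).

Lemma adE a u : ad a u = lie a u.
Proof. by rewrite lfunE. Qed.

Lemma ad_linear : linear ad.
Proof. by move=> c a a'; apply/lfunP => u;
  rewrite add_lfunE scale_lfunE !adE linearPl. Qed.

HB.instance Definition _ := GRing.isLinear.Build K L 'End(L) *:%R ad ad_linear.

End Adjoint.

Lemma ad_Der (K : fieldType) (L : lieType K) (a : L) : ad a \in Der L.
Proof.
apply/DerP => u v; rewrite !adE.
have /eqP := lie_jacobi a u v; rewrite -addrA addr_eq0 => /eqP ->.
by rewrite opprD -(lieC (lie a u)) (lieC v a) linearNr opprK addrC.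
Qed.

Section CharacteristicallyNilpotent.
Variables (K : fieldType) (n : lieType K).
Local Notation D := (der_series n).

Lemma der_series_Der k (f : 'End(n)) a : f \in Der n -> a \in D k -> f a \in D
  k.+1.
Proof. by move=> Df Da;
  apply: (apply_spaceP (Der n) (D k) (D k.+1) (subvv _)). Qed.

Lemma der_seriesS k : (D k.+1 <= D k)%VS.
Proof.
elim: k => [|k IH]; first exact: subvf.
rewrite [X in (X <= _)%VS]/(apply_space (Der n) (D k.+1)).
by apply/apply_spaceP => f a Df /(subvP IH); apply: der_series_Der.
Qed.

Lemma der_series_eq0 k j : D k = 0%VS -> D (k + j) = 0%VS.
Proof.
move=> Dk; elim: j => [|j IH]; rewrite ?addn0 // addnS; apply/eqP.
by rewrite -subv0 -IH der_seriesS.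
Qed.

Lemma Der_lcs (f : 'End(n)) k a : f \in Der n -> a \in lcs {:n} k -> f a \in
  lcs {:n} k.
Proof.
move=> /DerP fD; rewrite /lcs; elim: k.-1 a => [|j IH] a;
  first by rewrite !memvf.
move: a; apply: lieV_ind => [|c u v fu fv|u v _ Uv];
  first by rewrite linear0 mem0v.
  by rewrite linearP memvD ?memvZ.
by rewrite fD memvD // memv_lie ?memvf ?IH.
Qed.

(** Inner derivations are derivations; the index shifts because [lcs] starts at 1 and [der_series]
    at 0. *)
Lemma lcs_sub_der_series j : (lcs {:n} j.+1 <= D j)%VS.
Proof.
elim: j => [|j IH]; first exact: subvf.
apply/lieVP => a c _ /(subvP IH) Dc.
by have := der_series_Der (ad_Der a) Dc; rewrite adE.
Qed.

End CharacteristicallyNilpotent.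

(** * The bracket of L in terms of its components in n and V *)

Section LnBracket.
Variables (K : fieldType) (n : lieType K) (z0 : n).
Variables (V : vectType K) (m : nat) (x y : m.-tuple V).
Local Notation b := (symp x y).
Local Notation L := (Ln z0 x y).

Definition prn (p : L) : n := p.1.
Definition prV (p : L) : V := p.2.

Lemma prn_linear : linear prn. Proof. by []. Qed.
Lemma prV_linear : linear prV. Proof. by []. Qed.

HB.instance Definition _ := GRing.isLinear.Build K L n *:%R prn prn_linear.
HB.instance Definition _ := GRing.isLinear.Build K L V *:%R prV prV_linear.

Definition in_n (a : n) : L := inn z0 x y a.
Definition in_V (u : V) : L := inV z0 x y u.
HB.instance Definition _ :=
  GRing.isLinear.Build K n L *:%R in_n (inn_linear z0 x y).
HB.instance Definition _ :=
  GRing.isLinear.Build K V L *:%R in_V (inV_linear z0 x y).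

Lemma prn_n a : prn (in_n a) = a. Proof. by []. Qed.
Lemma prn_V u : prn (in_V u) = 0. Proof. by []. Qed.
Lemma prV_n a : prV (in_n a) = 0. Proof. by []. Qed.
Lemma prV_V u : prV (in_V u) = u. Proof. by []. Qed.

Lemma Ln_eq (p q : L) : prn p = prn q -> prV p = prV q -> p = q.
Proof. by case: p q => [a u] [c v]; rewrite /prn /prV /= => -> ->. Qed.

Lemma Ln_decomp (p : L) : p = in_n (prn p) + in_V (prV p).
Proof. by apply: Ln_eq;
  rewrite linearD /= ?prn_n ?prn_V ?prV_n ?prV_V ?addr0 ?add0r. Qed.

Lemma lie_LnE (p q : L) : lie p q = in_n (lie (prn p) (prn q) + b (prV p) (prV
  q) *: z0).
Proof. by []. Qed.

Lemma prn_lie (p q : L) :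
  prn (lie p q) = lie (prn p) (prn q) + b (prV p) (prV q) *: z0.
Proof. by []. Qed.

Lemma prV_lie (p q : L) : prV (lie p q) = 0. Proof. by []. Qed.

Lemma prnD (p q : L) : prn (p + q) = prn p + prn q. Proof. by []. Qed.
Lemma prVD (p q : L) : prV (p + q) = prV p + prV q. Proof. by []. Qed.

Lemma prVN (p : L) : prV (- p) = - prV p. Proof. by []. Qed.

Lemma lie_nn a c : lie (in_n a) (in_n c) = in_n (lie a c).
Proof. exact: lie_inn. Qed.

Lemma lie_VV u v : lie (in_V u) (in_V v) = b u v *: in_n z0.
Proof. exact: lie_inV. Qed.

Lemma lie_nV a u : lie (in_n a) (in_V u) = 0.
Proof. by rewrite lie_LnE prn_V prV_n linear0r linear0l scale0r addr0 linear0.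
  Qed.

Lemma lie_Vn u a : lie (in_V u) (in_n a) = 0.
Proof. by rewrite lieC lie_nV oppr0. Qed.

Hypothesis z0_central : z0 \in center n.

Lemma z0_lie a : lie z0 a = 0. Proof. by move/centerP: z0_central; apply. Qed.
Lemma lie_z0 a : lie a z0 = 0. Proof. by rewrite lieC z0_lie oppr0. Qed.

Lemma Ln_jacobi : jacobi L.
Proof.
move=> p q r; rewrite !lie_LnE !prn_n !prV_n !linear0r !scale0r !addr0
  -!linearD /=.
rewrite !linearDr /= !linearZr_LR /= !lie_z0 !scaler0 !addr0 lie_jacobi.
by rewrite linear0.
Qed.

End LnBracket.
Arguments in_n {K n z0 V m x y}.
Arguments in_V {K n z0 V m x y}.

Section LnDerivations.
Variables (K : fieldType) (n : lieType K) (n_charnil :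
  characteristically_nilpotent n).
Hypothesis n_center2 : forall a : n,
  (forall c : n, lie a c \in center n) -> a \in lcs {:n} 2.
Variables (z0 : n) (z0_central : z0 \in center n) (z0_neq0 : z0 != 0).
Variables (m : nat) (m_gt0 : (0 < m)%N) (V : vectType K) (x y : m.-tuple V).
Hypothesis xy_basis : basis_of {:V} (x ++ y).
Local Notation b := (symp x y).
Local Notation L := (Ln z0 x y).
Local Notation n2 := (lcs {:n} 2).

Lemma z0_n2 : z0 \in n2.
Proof. by apply: n_center2 => c; rewrite (z0_lie z0_central) mem0v. Qed.

Lemma lie_n2 a c : lie a c \in n2.
Proof. by rewrite memv_lie ?memvf. Qed.

Definition compress_n (d : 'End(L)) : 'End(n) :=
  (linfun (@prn _ _ z0 _ _ x y) \o d \o linfun in_n)%VF.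

Lemma compress_nE d a : compress_n d a = prn (d (in_n a)).
Proof. by rewrite !lfun_simp. Qed.

(** The first two conditions are the Leibniz rule on n x n, the third is the one on V x n, and the
    rule on V x V splits into the last two because [d] annihilates [z0]. *)
Lemma Der_LnP (d : 'End(L)) :
  reflect [/\ forall a c, prn (d (in_n (lie a c))) =
                          lie (prn (d (in_n a))) c + lie a (prn (d (in_n c))),
              {in n2, forall a, prV (d (in_n a)) = 0},
              forall u a, lie (prn (d (in_V u))) a = - b u (prV (d (in_n a)))
                *: z0,
              prn (d (in_n z0)) = 0
            & forall u v, b (prV (d (in_V u))) v + b u (prV (d (in_V v))) = 0]
          (d \in Der L).
Proof.
apply: (iffP (DerP d)) => [dD | [d1 d2 d3 d4 d5] p q]; last first.
  have dz0 : d (in_n z0) = 0.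
    by apply: Ln_eq; rewrite ?d4 ?d2 ?z0_n2 ?linear0.
  have dlie a c k : d (in_n (lie a c + k *: z0)) = d (in_n (lie a c)).
    by rewrite [in_n _]linearD linearD /= [in_n (_ *: _)]linearZ linearZ /= dz0
      scaler0 addr0.
  rewrite [lie p q]lie_LnE dlie.
  have dE r : d r = d (in_n (prn r)) + d (in_V (prV r)) by rewrite
    {1}[r]Ln_decomp linearD.
  apply: Ln_eq; last by rewrite d2 ?lie_n2 // prVD !prV_lie addr0.
  rewrite d1 prnD !prn_lie (dE p) (dE q) !prnD !prVD.
  move: (prn p) (prV p) (prn q) (prV q) => a u c v.
  rewrite [lie (_ + _) c]linearDl [lie a (_ + _)]linearDr /= (lieC a (prn (d
    (in_V v)))) !d3.
  rewrite [b (_ + _) v]linearDl [b u (_ + _)]linearDr /= !scalerDl.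
  have /eqP := d5 u v; rewrite addr_eq0 => /eqP ->.
  rewrite -scaleNr opprK (sympC x y v) -!scalerDl.
  set A := lie _ c; set B := lie a _; set s := b _ v;
    set t := b u (prV (d (in_n c))).
  set r := b u _; rewrite addrA (addrAC (A + _)) [A + _ + (B + _)]addrACA
    -[LHS]addr0 -!addrA.
  congr (_ + (_ + _)); rewrite -!scalerDl -[LHS](scale0r z0); congr (_ *: _).
  by ring.
have d1 a c : prn (d (in_n (lie a c))) = lie (prn (d (in_n a))) c + lie a (prn
  (d (in_n c))).
  by rewrite -lie_nn dD prnD !prn_lie !prV_n linear0r linear0l !scale0r !addr0.
have d2 : {in n2, forall a, prV (d (in_n a)) = 0}.
  apply: lieV_ind => [|k a c a0 c0|a c _ _]; first by rewrite !linear0.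
    by rewrite !linearP /= a0 c0 scaler0 addr0.
  by rewrite -lie_nn dD prVD !prV_lie addr0.
have d3 u a : lie (prn (d (in_V u))) a = - b u (prV (d (in_n a))) *: z0.
  have /(congr1 (@prn _ _ z0 _ _ x y)) := dD (in_V u) (in_n a).
  rewrite lie_Vn !linear0 prnD !prn_lie prn_V prV_n prV_V linear0r linear0l.
  by rewrite scale0r addr0 add0r => /esym/eqP; rewrite addr_eq0 scaleNr => /eqP.
have d6 u v : b u v *: prn (d (in_n z0)) =
    (b (prV (d (in_V u))) v + b u (prV (d (in_V v)))) *: z0.
  have /(congr1 (@prn _ _ z0 _ _ x y)) := dD (in_V u) (in_V v).
  rewrite lie_VV prnD !prn_lie !prn_V !prV_V linear0r linear0l !add0r -scalerDl.
  by rewrite !linearZ.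
have d4 : prn (d (in_n z0)) = 0.
  (* The pair [x_i0], [y_i0] turns [d6] into [d(z0) = c z0] in the n-component. If [c] were nonzero,
     [z0] would be a multiple of its own image under a derivation of n and survive in every term of
     [der_series]. *)
  pose i0 := Ordinal m_gt0.
  have := d6 (tnth x i0) (tnth y i0); rewrite symp_xy // eqxx scale1r.
  move: (_ + _) => c dz0; rewrite dz0; apply/eqP; rewrite scaler_eq0.
  apply/orP; left; apply/negPn/negP => c0.
  have [k Dk0] := n_charnil.
  suff : z0 \in der_series n k by rewrite Dk0 memv0 (negPf z0_neq0).
  elim: k {Dk0} => [|k Dk]; first by rewrite [der_series n 0]/(fullv) memvf.
  have <- : c^-1 *: compress_n d z0 = z0.
    by rewrite compress_nE dz0 scalerA mulVf ?scale1r.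
  by apply/memvZ/der_series_Der => //; apply/DerP => a a'; rewrite !compress_nE.
split=> // u v; have /eqP := d6 u v; rewrite d4 scaler0 eq_sym scaler_eq0.
by rewrite (negPf z0_neq0) orbF => /eqP.
Qed.

(** The third block condition puts all brackets with this element into the line of [z0], hence into
    the center, and [n_center2] applies. *)
Lemma Der_in_V (d : 'End(L)) u : d \in Der L -> prn (d (in_V u)) \in n2.
Proof.
case/Der_LnP=> _ _ d3 _ _; apply: n_center2 => c.
by rewrite d3 memvZ.
Qed.

Lemma compress_n_Der (d : 'End(L)) : d \in Der L -> compress_n d \in Der n.
Proof. by case/Der_LnP=> d1 *; apply/DerP => a c; rewrite !compress_nE. Qed.

Lemma sp_star_Der (d : 'End(L)) : d \in sp_star z0 x y -> d \in Der L.
Proof.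
case/sp_starP=> dV dsp dn.
have dn' a : d (in_n a) = 0 by apply: dn.
have dV' u : prn (d (in_V u)) = 0 by have [v dv] := dV u; rewrite [d _]dv.
apply/Der_LnP; split=> [a c|a _|u a||u v]; rewrite ?dn' ?dV' ?linear0 //.
- by rewrite linear0l linear0r addr0.
- by rewrite linear0l linear0r oppr0 scale0r.
- exact: dsp.
Qed.

Lemma N_der_Der (d : 'End(L)) : d \in N_der z0 x y -> d \in Der L.
Proof.
case/N_derP=> dV [f /DerP fD df] dz.
have df' a : d (in_n a) = in_n (f a) by apply: df.
have dV' u : d (in_V u) = 0 by apply: dV.
have fz : f z0 = 0 by have /(congr1 (@prn _ _ z0 _ _ x y)) := df' z0;
  rewrite [d _]dz.
apply/Der_LnP; split=> [a c|a _|u a||u v];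
  rewrite ?df' ?dV' ?prn_n ?prV_n ?linear0 //.
- by rewrite linear0l linear0r oppr0 scale0r.
- by rewrite linear0l linear0r addr0.
Qed.

Lemma N_mix_Der (d : 'End(L)) : d \in N_mix z0 x y -> d \in Der L.
Proof.
case/N_mixP=> dV dn dn2 dVn.
have dV' u : prV (d (in_V u)) = 0 by have [a _ da] := dV u; rewrite [d _]da.
have dn' a : prn (d (in_n a)) = 0 by have [v dv] := dn a; rewrite [d _]dv.
apply/Der_LnP; split=> [a c|a n2a|u a||u v]; rewrite ?dn' ?dV' //.
- by rewrite linear0l linear0r addr0.
- by rewrite [d _]dn2.
- have E : lie (d (in_V u)) (in_n a) = - b u (prV (d (in_n a))) *: in_n z0 :=
    dVn u a.
  by move/(congr1 (@prn _ _ z0 _ _ x y)): E;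
    rewrite prn_lie prV_n linear0r scale0r addr0.
- by rewrite linear0l linear0r addr0.
Qed.

Local Notation N := (N_der z0 x y + N_mix z0 x y)%VS.

(** Such a derivation has no V -> V block: its n -> n block belongs to [N_der], and the two
    off-diagonal blocks together belong to [N_mix]. *)
Lemma N_LnP (d : 'End(L)) :
  reflect (d \in Der L /\ forall u, prV (d (in_V u)) = 0) (d \in N).
Proof.
apply: (iffP idP) => [/memv_addP[p pN [q qN ->]]|[dD dV]].
  split; first by apply: memvD; [exact: N_der_Der | exact: N_mix_Der].
  move=> u; rewrite lfun_simp prVD.
  have [pV _ _] := N_derP p pN; have [qV _ _ _] := N_mixP q qN.
  have [a _ qa] := qV u.
  by rewrite [p _]pV [q _]qa linear0 add0r.
pose p : 'End(L) := (linfun in_n \o compress_n d \o linfun (@prn _ _ z0 _ _ x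
  y))%VF.
have pE r : p r = in_n (compress_n d (prn r)) by rewrite comp_lfunE comp_lfunE
  !lfunE.
have [d1 d2 d3 d4 d5] := Der_LnP d dD.
rewrite -[d](subrK p) addrC; apply: memv_add.
  apply/N_derP; split=> [u||].
  - by rewrite pE prn_V !linear0.
  - by exists (compress_n d); [apply: compress_n_Der | move=> a; rewrite pE].
  - by rewrite pE prn_n compress_nE d4 linear0.
have qn a : (d - p) (in_n a) = in_V (prV (d (in_n a))).
  rewrite add_lfunE opp_lfunE pE prn_n compress_nE [d (in_n a)]Ln_decomp.
  by rewrite addrAC prnD prn_n prn_V addr0 subrr add0r prVD prV_n prV_V add0r.
have qV u : (d - p) (in_V u) = in_n (prn (d (in_V u))).
  rewrite add_lfunE opp_lfunE pE prn_V !linear0 addr0 {1}[d (in_V u)]Ln_decomp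
    dV.
  by rewrite linear0 addr0.
apply/N_mixP; split=> [u|a|a n2a|u a].
- by exists (prn (d (in_V u))); [apply: Der_in_V | apply: qV].
- by exists (prV (d (in_n a))); apply: qn.
- by rewrite [LHS]qn d2 // linear0.
- rewrite [(d - p) (inV _ _ _ u)]qV [(d - p) (inn _ _ _ a)]qn lie_inn d3.
  exact: linearZ.
Qed.

Lemma Der_Ln : Der L = (sp_star z0 x y + N)%VS.
Proof.
apply/eqP; rewrite eqEsubv; apply/andP; split; apply/subvP => d; last first.
  by case/memv_addP=> s /sp_star_Der sD [q /N_LnP[qD _] ->]; apply: memvD.
move=> dD; have [d1 d2 d3 d4 d5] := Der_LnP d dD.
pose s : 'End(L) := (linfun in_V \o linfun (@prV _ _ z0 _ _ x y) \o d \o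
  linfun in_V \o linfun (@prV _ _ z0 _ _ x y))%VF.
have sE r : s r = in_V (prV (d (in_V (prV r)))) by do 4!rewrite comp_lfunE;
  rewrite !lfunE.
have sS : s \in sp_star z0 x y.
  apply/sp_starP; split=> [u|u v|a].
  - by exists (prV (d (in_V u))); rewrite sE prV_V.
  - rewrite !sE; exact: (d5 u v).
  - by rewrite sE prV_n !linear0.
rewrite -[d](subrK s) addrC; apply: memv_add => //; apply/N_LnP; split.
  by apply: memvB => //; apply: sp_star_Der.
by move=> u; rewrite add_lfunE opp_lfunE sE prVD prVN !prV_V subrr.
Qed.

Lemma sp_star_N0 : (sp_star z0 x y :&: N = 0)%VS.
Proof.
apply/eqP; rewrite -subv0;
  apply/subvP => d /memv_capP[/sp_starP[dV _ dn] /N_LnP[_ dV0]].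
rewrite memv0; apply/eqP/lfunP => r;
  rewrite [RHS]lfunE [r]Ln_decomp linearD /= [d (in_n _)]dn add0r.
have [v dv] := dV (prV r); have := dV0 (prV r).
by rewrite [d _]dv => v0; rewrite [LHS](congr1 in_V (v0 : v = 0)) linear0.
Qed.

Lemma N_der_N_mix0 : (N_der z0 x y :&: N_mix z0 x y = 0)%VS.
Proof.
apply/eqP; rewrite -subv0;
  apply/subvP => d /memv_capP[/N_derP[dV [f _ df] _] /N_mixP[_ dn _ _]].
rewrite memv0; apply/eqP/lfunP => r;
  rewrite [RHS]lfunE [r]Ln_decomp linearD /= [d (in_V _)]dV addr0.
have [v] := dn (prn r);
  rewrite [d _]df => /(congr1 (@prn _ _ z0 _ _ x y)) /= f0.
have -> : f (prn r) = 0 by [].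
by rewrite linear0.
Qed.

End LnDerivations.

(** * The filtration, nilpotency of N, and the nilindex of L *)

Section LnDerivations.
Variables (K : fieldType) (n : lieType K) (n_charnil :
  characteristically_nilpotent n).
Hypothesis n_center2 : forall a : n,
  (forall c : n, lie a c \in center n) -> a \in lcs {:n} 2.
Variables (z0 : n) (z0_central : z0 \in center n) (z0_neq0 : z0 != 0).
Variables (m : nat) (m_gt0 : (0 < m)%N) (V : vectType K) (x y : m.-tuple V).
Hypothesis xy_basis : basis_of {:V} (x ++ y).
Local Notation b := (symp x y).
Local Notation L := (Ln z0 x y).
Local Notation n2 := (lcs {:n} 2).

Local Notation D := (der_series n).
Local Notation N := (N_der z0 x y + N_mix z0 x y)%VS.

Let z0n2 : z0 \in n2 := z0_n2 n_center2 z0_central.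
Let DerP' (d : 'End(L)) := Der_LnP n_charnil n_center2 z0_central z0_neq0 m_gt0
  xy_basis d.
Let NP (d : 'End(L)) := N_LnP n_charnil n_center2 z0_central z0_neq0 m_gt0
  xy_basis d.
Let Der_V (d : 'End(L)) u : d \in Der L -> prn (d (in_V u)) \in n2.
Proof. by apply: (Der_in_V n_charnil n_center2 z0_central z0_neq0 m_gt0
  xy_basis). Qed.
Let Der_n (d : 'End(L)) : d \in Der L -> compress_n d \in Der n.
Proof. by apply: (compress_n_Der n_charnil n_center2 z0_central z0_neq0 m_gt0
  xy_basis). Qed.

Lemma Ln_appE (d : 'End(L)) p : d p = d (in_n (prn p)) + d (in_V (prV p)).
Proof. by rewrite {1}[p]Ln_decomp linearD. Qed.

Lemma Der_filtration_quo (d : 'End(L)) i p : d \in Der L ->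
  prn p \in (D i + n2)%VS -> prn (d p) \in (D i.+1 + n2)%VS.
Proof.
move=> dD /memv_addP[a Da [c n2c Ep]];
  rewrite Ln_appE prnD -compress_nE Ep linearD /=.
rewrite -addrA memv_add ?der_series_Der ?Der_n //.
by rewrite memvD ?Der_V ?Der_lcs ?Der_n.
Qed.

Lemma Der_filtration_n2 (d : 'End(L)) i a : d \in Der L -> a \in (n2 :&: D
  i)%VS ->
  exists2 c, c \in (n2 :&: D i.+1)%VS & d (in_n a) = in_n c.
Proof.
move=> dD /memv_capP[n2a Da]; exists (compress_n d a).
  by rewrite memv_cap Der_lcs ?der_series_Der ?Der_n.
have [_ d2 _ _ _] := DerP' d dD.
by rewrite [LHS]Ln_decomp d2 // linear0 addr0 compress_nE.
Qed.

(* With D k = 0, N maps each term of L = n + V >= ... >= (D i + n^2) + V >= ...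
   >= n^2 + V >= n^2 >= ... >= n^2 cap D j >= ... >= 0 into the next one. *)
Definition filtration k i (p : L) : Prop :=
  if (i <= k)%N then is_true (prn p \in (D i + n2)%VS)
  else prV p = 0 /\ prn p \in (n2 :&: D (i - k.+1))%VS.

Lemma filtrationP k i a p q :
  filtration k i p -> filtration k i q -> filtration k i (a *: p + q).
Proof.
rewrite /filtration; case: ifP => _ => [pi qi|[pV pn] [qV qn]].
  by rewrite linearP memvD ?memvZ.
by rewrite !linearP /= pV qV scaler0 addr0 memvD ?memvZ.
Qed.

Lemma filtration0 k p : filtration k 0 p.
Proof. by rewrite /filtration leq0n; apply: (subvP (addvSl _ _));
  rewrite -[D 0]/(fullv) memvf. Qed.

Lemma filtration_end k p : D k = 0%VS -> filtration k (k + k.+1) p -> p = 0.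
Proof.
(* At index [k + k.+1] the second branch applies with [D k], which is zero. *)
move=> Dk; rewrite /filtration addnS ltnNge leq_addr /= subSS addnK Dk capv0
  memv0.
by case=> pV /eqP pn; apply: Ln_eq; rewrite linear0.
Qed.

Lemma filtration_N k i (d : 'End(L)) p : D k = 0%VS -> d \in N ->
  filtration k i p -> filtration k i.+1 (d p).
Proof.
move=> Dk /NP[dD dV0]; have [_ d2 _ _ _] := DerP' d dD; rewrite /filtration.
case: (ltngtP i k) => [ltik|ltki|->]; first exact: Der_filtration_quo.
  case=> pV pn; have [c cD Ec] := Der_filtration_n2 dD pn.
  rewrite Ln_appE pV Ec !linear0 addr0 prV_n prn_n subSn //.
(* At the crossing [i = k] the n-component lies in [n2]. The image has no V-component, since [d]
   maps V into n and no element of [n2] has an image with one; the target is [n2 :&: D 0]. *)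
rewrite subnn Dk add0v => n2p; split.
  by rewrite Ln_appE prVD dV0 d2 // addr0.
rewrite memv_cap [D 0]/(fullv) memvf andbT Ln_appE prnD memvD ?Der_V //.
by rewrite -compress_nE Der_lcs ?Der_n.
Qed.

Lemma N_nilpotent_operators :
  {in N, forall d : 'End(L), exists k, forall p, iter k d p = 0}.
Proof.
move=> d dN; have [k Dk] := n_charnil; exists (k + k.+1)%N => p.
apply: (filtration_end Dk); elim: (_ + _)%N => [|i IH];
  first exact: filtration0.
exact: filtration_N.
Qed.

Lemma N_ideal : ideal_of N (Der L).
Proof.
split; first by apply/subvP => d /NP[].
apply/lieVP => e d eD /NP[dD dV]; have [_ e2 _ _ _] := DerP' e eD.
have [_ d2 _ _ _] := DerP' d dD.
apply/NP; split=> [|u].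
  have /DerP eD' := eD; have /DerP dD' := dD.
  apply/DerP => p q; rewrite !lie_lfunE eD' dD' [e (_ + _)]linearD [d (_ +
    _)]linearD /=.
  rewrite !eD' !dD' [lie (_ - _) q]linearBl [lie p (_ - _)]linearBr /=.
  move: (lie (e (d p)) q) (lie (d p) (e q)) (lie (e p) (d q)) (lie p (e (d q)))
    => A1 A2 A3 A4.
  move: (lie (d (e p)) q) (lie p (d (e q))) => A5 A6.
  rewrite !opprD !addrA (ACl (1*5*4*8*(2*7)*(3*6))%AC) /=.
  by rewrite !subrr !addr0.
(* The V -> V block of the commutator vanishes: [d] sends V into [n2], both derivations send [n2]
   into n, and [d] sends V into n. *)
rewrite lie_lfunE prVD prVN [d (in_V u)]Ln_decomp dV linear0 addr0.
rewrite (e2 _ (Der_V u dD)) [d (e _)]Ln_appE prVD dV addr0.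
by rewrite (d2 _ (Der_V u eD)) subrr.
Qed.

Lemma N_nilpotent : nilpotent N.
Proof.
have [k Dk] := n_charnil; exists (k + k.+1)%N; apply/eqP; rewrite -subv0;
  apply/subvP => f Nf.
rewrite memv0; apply/eqP/lfunP => p; rewrite [RHS]lfunE /=;
  apply: (filtration_end Dk).
(* The term of index [j.+1] of the lower central series of N shifts the filtration by [j.+1]
   steps. *)
suff gen j g : g \in lcs N j.+1 -> forall i q, filtration k i q -> filtration k
  (i + j.+1) (g q).
  by rewrite addnS in Nf *; apply: (gen _ _ Nf 0); apply: filtration0.
elim: j g => [|j IH] g; first by move=> Ng i q; rewrite addn1;
  apply: filtration_N.
move: g; apply: lieV_ind => [i q _|a g h IHg IHh i q Fq|d g Nd Ng i q Fq].
- rewrite lfunE /= /filtration; case: ifP => _; first by rewrite linear0 mem0v.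
  by split; rewrite linear0 ?mem0v.
- by rewrite !lfun_simp; apply: filtrationP; [apply: IHg | apply: IHh].
rewrite lie_lfunE addrC -scaleN1r; apply: filtrationP.
  by rewrite -addSnnS; apply: (IH g Ng); apply: filtration_N.
by rewrite addnS; apply: filtration_N => //; apply: IH.
Qed.


Lemma lieV_Ln (U : {vspace n}) :
  lieV {:L} (linfun in_n @: U) = (linfun in_n @: lieV {:n} U)%VS.
Proof.
have nE a : linfun in_n a = in_n a :> L by rewrite lfunE.
apply/eqP; rewrite eqEsubv; apply/andP; split.
  apply/lieVP => p _ _ /memv_imgP[a Ua ->]; rewrite nE.
  have -> : lie p (in_n a) = linfun in_n (lie (prn p) a).
    by rewrite nE lie_LnE prn_n prV_n linear0r scale0r addr0.
  by rewrite memv_img // memv_lie ?memvf.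
apply/subvP => _ /memv_imgP[c Uc ->]; move: c Uc.
apply: lieV_ind => [|k a c Ha Hc|a c _ Uc]; first by rewrite linear0 mem0v.
  by rewrite linearP memvD ?memvZ.
by rewrite nE -lie_nn -(nE c) memv_lie ?memvf // memv_img.
Qed.

(** Brackets within V add only multiples of [z0], already in [n2], so the two series agree from
    index 2 on. *)
Lemma lcs_Ln j : lcs {:L} j.+2 = (linfun in_n @: lcs {:n} j.+2)%VS.
Proof.
have nE a : linfun in_n a = in_n a :> L by rewrite lfunE.
elim: j => [|j IH]; last first.
  by rewrite -[LHS]/(lieV {:L} (lcs {:L} j.+2)) IH lieV_Ln.
apply/eqP; rewrite eqEsubv; apply/andP; split.
  apply/lieVP => p q _ _; rewrite lie_LnE -nE memv_img // memvD ?memvZ //.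
  exact: lie_n2.
by rewrite -[X in (X <= _)%VS](lieV_Ln {:n}); apply: lieVS; apply: subvf.
Qed.

Lemma same_nilindex :
  nilpotent {:L} /\ exists t, nilindex {:n} t /\ nilindex {:L} t.
Proof.
have lcs0 j : lcs {:L} j.+2 = 0%VS <-> lcs {:n} j.+2 = 0%VS.
  rewrite lcs_Ln; split=> [n0|->]; last by rewrite limg0.
  apply/eqP; rewrite -subv0; apply/subvP => a na.
  have : linfun in_n a \in (linfun in_n @: lcs {:n} j.+2 : {vspace L})%VS by
    apply: memv_img.
  rewrite n0 !memv0 lfunE => /eqP Ea; apply/eqP.
  exact: (congr1 (@prn _ _ z0 _ _ x y) Ea).
have n2_neq0 : lcs {:n} 2 <> 0%VS.
  by move=> n20; move: z0n2; rewrite n20 memv0 (negPf z0_neq0).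
have [k Dk] := n_charnil.
have nk : lcs {:n} k.+1 = 0%VS by apply/eqP;
  rewrite -subv0 -Dk lcs_sub_der_series.
have n_eq0 s : (k < s)%N -> lcs {:n} s = 0%VS.
  elim: s => // s IH; rewrite ltnS leq_eqVlt => /orP[/eqP<- // | ltks].
  case: s IH ltks => // s IH ltks;
    rewrite -[LHS]/(lieV {:n} (lcs {:n} s.+1)) IH //.
  by apply/eqP; rewrite -subv0; apply/lieVP => a c _; rewrite memv0 => /eqP->;
    rewrite linear0r mem0v.
split.
  by exists k.+2; apply/lcs0/n_eq0.
have ex2 : exists t, lcs {:n} t != 0%VS by exists 2; apply/eqP.
have bound t : lcs {:n} t != 0%VS -> (t <= k)%N.
  by move=> t0; rewrite leqNgt; apply: contra t0 => /n_eq0 ->.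
have [t t0 tmax] := ex_maxnP ex2 bound.
have tmax' s : lcs {:n} s <> 0%VS -> (s <= t)%N by move/eqP; apply: tmax.
(* [z0] makes [n2] nonzero, so the nilindex lies in the range where the two series agree. *)
have t2 : (2 <= t)%N by apply: tmax'.
exists t; split; first by split=> //; apply/eqP.
split.
  case: t t0 t2 {tmax tmax'} => [|[|t]] // t0 _ /lcs0 t1.
  by rewrite t1 eqxx in t0.
move=> [|[|s]] s0 //; first exact: ltnW.
by apply: tmax' => /lcs0.
Qed.

End LnDerivations.

(** * Conjugating a semisimple algebra of derivations into sp* *)

Section UnipotentAutomorphism.
Variables (K : fieldType) (charK : [pchar K] =i pred0) (L : skewAlgType K).
Variable q : 'End(L).
Hypotheses (qD : q \in Der L) (q_lie : forall p r, q (lie p r) = 0).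
Hypothesis q3 : forall p, q (q (q p)) = 0.

(* exp f, when f^3 = 0 *)
Definition exp3 (f : 'End(L)) : 'End(L) := (\1 + f + 2^-1 *: (f \o f))%VF.

Lemma exp3E (f : 'End(L)) p : exp3 f p = p + f p + 2^-1 *: f (f p).
Proof. by rewrite add_lfunE add_lfunE scale_lfunE id_lfunE comp_lfunE. Qed.

Let two_neq0 : 2 != 0 :> K. Proof. by rewrite ((pcharf0P K).1 charK). Qed.

(** A derivation vanishing on brackets is skew for the bracket, so [[exp q p, exp q r] =
    [p, exp(-q) exp(q) r] = [p, r]], and [exp q] fixes brackets. *)
Lemma exp3_morphism : lie_morphism (exp3 q).
Proof.
move=> p r; have skew u v : lie (q u) v = - lie u (q v).
  by apply/eqP; rewrite -addr_eq0; have /DerP <- := qD; rewrite q_lie.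
have lieD u v w : lie (u + v) w = lie u w + lie v w by rewrite linearDl.
have lieDr u v w : lie u (v + w) = lie u v + lie u w by rewrite linearDr.
have half (v : L) : 2^-1 *: v + 2^-1 *: v = v.
  by rewrite -scalerDl -[X in X + _]mul1r -[X in _ + X]mul1r -mulrDl mulfV
    ?scale1r.
have q0 : q 0 = 0 by rewrite linear0.
have lie0 u : lie u 0 = 0 by rewrite linear0r.
have lieN u v : lie u (- v) = - lie u v by rewrite linearNr.
have lieZl k u v : lie (k *: u) v = k *: lie u v by rewrite linearZl_LR.
have lieZr k u v : lie u (k *: v) = k *: lie u v by rewrite linearZr_LR.
rewrite !exp3E q_lie linear0 scaler0 !addr0 !lieD !lieDr !lieZl !lieZr !skew
  !q3.
rewrite q0 !lie0 !oppr0 !scaler0 !addr0.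
set A := lie p (q (q r)); set B := lie p (q r).
rewrite opprK; set H := 2^-1 *: A; have := half A; rewrite -/H;
  clearbody H => <-.
by rewrite opprD !addrA (ACl (1*(2*4)*(3*5)*(6*7))%AC) /= !subrr addNr !addr0.
Qed.

Lemma exp3K : cancel (exp3 q) (exp3 (- q)).
Proof.
move=> p; have half (v : L) : 2^-1 *: v + 2^-1 *: v = v.
  by rewrite -scalerDl -[X in X + _]mul1r -[X in _ + X]mul1r -mulrDl mulfV
    ?scale1r.
have qD' u v : q (u + v) = q u + q v by rewrite linearD.
have qZ k u : q (k *: u) = k *: q u by rewrite linearZ.
have qN u : q (- u) = - q u by rewrite linearN.
rewrite !exp3E !opp_lfunE !qN opprK !qD' !qZ !q3 !scaler0 !addr0.
rewrite (linear0 q) scaler0 addr0; set A := q (q p); set H := 2^-1 *: A.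
have := half A; rewrite -/H; clearbody H => <-.
by rewrite !opprD !addrA (ACl (1*(2*4)*(3*5)*(7*6))%AC) /= !subrr !addr0.
Qed.

End UnipotentAutomorphism.

Section Straightening.
Variables (K : fieldType) (charK : [pchar K] =i pred0).
Variables (n : lieType K) (n_charnil : characteristically_nilpotent n).
Hypothesis n_center2 : forall a : n,
  (forall c : n, lie a c \in center n) -> a \in lcs {:n} 2.
Variables (z0 : n) (z0_central : z0 \in center n) (z0_neq0 : z0 != 0).
Variables (m : nat) (m_gt0 : (0 < m)%N) (V : vectType K) (x y : m.-tuple V).
Hypothesis xy_basis : basis_of {:V} (x ++ y).
Local Notation b := (symp x y).
Local Notation L := (Ln z0 x y).
Local Notation n2 := (lcs {:n} 2).

Local Notation D := (der_series n).
Let DerP' (d : 'End(L)) := Der_LnP n_charnil n_center2 z0_central z0_neq0 m_gt0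
  xy_basis d.
Variable S : {vspace 'End(L)}.
Hypotheses (SD : (S <= Der L)%VS) (ssS : semisimple S).

Let S_Der d : d \in S -> d \in Der L. Proof. exact: (subvP SD). Qed.

Let perfect : lieV S S = S. Proof. exact (@semisimple_perfect K charK _ S ssS).
  Qed.

(** Words of length [k] in derivations send [n2] into [D k], which is zero, and perfectness of [S]
    passes from long words to single operators. *)
Lemma semisimple_n2 d a : d \in S -> a \in n2 -> d (in_n a) = 0.
Proof.
move=> Sd n2a; have [k Dk] := n_charnil.
apply/eqP; rewrite -memv0;
  apply: (perfect_word_stable perfect (k := k)) => // c Sc lek.
have [a' a'D ->] : exists2 a', a' \in (n2 :&: D (size c))%VS & act_word c (in_n
  a) = in_n a'.
  elim: c Sc {lek} => [|f c IH] Sc.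
    by exists a; rewrite // memv_cap n2a -[D 0]/(fullv) memvf.
  case/andP: Sc => Sf /IH[a1 a1D E].
  have [a2 a2D E2] := Der_filtration_n2 n_charnil n_center2 z0_central z0_neq0
    m_gt0 xy_basis (S_Der Sf) a1D.
  by exists a2; rewrite // -[LHS]/(f (act_word c (in_n a))) E.
move: a'D; rewrite -(subnKC lek) (der_series_eq0 _ Dk) capv0 memv0 => /eqP->.
by rewrite linear0 mem0v.
Qed.

(** The same argument modulo [n2] and V. *)
Lemma semisimple_prn d p : d \in S -> prn (d p) \in n2.
Proof.
move=> Sd; have [k Dk] := n_charnil.
have : d p \in (linfun (@prn _ _ z0 _ _ x y) @^-1: n2)%VS.
  apply: (perfect_word_stable perfect (k := k)) => // c Sc lek.
  have : prn (act_word c p) \in (D (size c) + n2)%VS.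
    elim: c Sc {lek} => [|f c IH] Sc.
      by apply: (subvP (addvSl _ _)); rewrite -[D 0]/(fullv) memvf.
    case/andP: Sc => Sf /IH; rewrite -[act_word (f :: c) p]/(f (act_word c p)).
    exact: (Der_filtration_quo n_charnil n_center2 z0_central z0_neq0 m_gt0
      xy_basis (S_Der Sf)).
  by rewrite -(subnKC lek) (der_series_eq0 _ Dk) add0v -memv_preim lfunE.
by rewrite -memv_preim lfunE.
Qed.

Let W := actv S {:L}.
Let fixed : {vspace L} := solv1 S (fun p (d : 'End(L)) => d p).

Let fixedP p : reflect {in S, forall d : 'End(L), d p = 0} (p \in fixed).
Proof. by apply: solv1P => [d a u v|u a d d']; rewrite ?linearP ?lfun_simp. Qed.

Let n2_fixed a : a \in n2 -> in_n a \in fixed.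
Proof. by move=> n2a; apply/fixedP => d Sd; apply: semisimple_n2. Qed.

Let W_n2 w : w \in W -> prn w \in n2.
Proof.
move: w; apply: actv_ind => [|a u v un vn|d p Sd _];
  first by rewrite linear0 mem0v.
  by rewrite linearP memvD ?memvZ.
exact: semisimple_prn.
Qed.

Let SW d p : d \in S -> d p \in W.
Proof. by move=> Sd; apply: memv_actv; rewrite ?memvf. Qed.

Let W_split : (W + fixed = fullv)%VS /\ (W :&: fixed = 0)%VS.
Proof.
have full : {in S, forall f : 'End(L), stabilises fullv f} by move=> f _;
  apply: subvf.
have [dec0 cap0] := @semisimple_splitting K charK _ S ssS fullv full.
split; apply/eqP.
  rewrite eqEsubv subvf; apply/subvP => p _.
  by have [u [v [-> Wu _ v0]]] := dec0 p (memvf p); apply: memv_add => //;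
    apply/fixedP.
by rewrite -subv0; apply/subvP => p /memv_capP[Wp /fixedP];
  rewrite memv0 => /(cap0 _ Wp) ->.
Qed.

(** For [w = d r] and [p] fixed, the bracket of [w] and [p] is [d] of a bracket, and [S] kills
    [n2]. *)
Let W_fixed w p : w \in W -> p \in fixed -> lie w p = 0.
Proof.
move=> Ww /fixedP p0; move: w Ww; apply: actv_ind => [|a u v u0 v0|d r Sd _].
- exact: linear0l.
- by rewrite linearPl /= u0 v0 scaler0 addr0.
have /DerP dD := S_Der Sd.
have := dD r p; rewrite p0 // linear0r addr0 => <-.
have z0n2 := z0_n2 n_center2 z0_central.
by rewrite lie_LnE semisimple_n2 // memvD ?memvZ ?lie_n2.
Qed.

Let W_prn_lie w a : w \in W -> a \in n2 -> lie (prn w) a = 0.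
Proof.
move=> Ww n2a; have /(congr1 (@prn _ _ z0 _ _ x y)) := W_fixed Ww (n2_fixed
  n2a).
by rewrite prn_lie prV_n linear0r scale0r addr0.
Qed.

Let W_lie w w' : w \in W -> w' \in W -> lie w w' = in_n (b (prV w) (prV w') *:
  z0).
Proof. by move=> Ww Ww'; rewrite lie_LnE W_prn_lie ?W_n2 ?add0r. Qed.

Let pr : 'End(L) := daddv_pi W fixed.

Let pr_W p : pr p \in W. Proof. exact: memv_pi. Qed.

Let pr_fixed p : p - pr p \in fixed.
Proof.
have E := daddv_pi_add W_split.2 (_ : p \in (W + fixed)%VS).
rewrite -{1}E ?W_split.1 ?memvf // addrC addKr; exact: memv_pi.
Qed.

Let pr_id w : w \in W -> pr w = w.
Proof. exact: daddv_pi_id W_split.2. Qed.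

Let pr0 p : p \in fixed -> pr p = 0.
Proof.
move=> fp; apply/eqP; rewrite -memv0 -W_split.2 memv_cap pr_W.
by rewrite -[pr p](subKr p) memvB.
Qed.

(** [in_V u - pr (in_V u)] is fixed, hence commutes with [w]; its n-component lies in [n2] and
    commutes with [prn w], which leaves only the form [b]. *)
Let pr_V u w : w \in W -> b (prV (pr (in_V u))) (prV w) = b u (prV w).
Proof.
move=> Ww; set w' := pr (in_V u).
have n2p : prn (in_V u - w') \in n2.
  by rewrite -[prn _]/(prn (in_V u) - prn w') prn_V sub0r memvN W_n2 ?pr_W.
have /(W_fixed Ww)/(congr1 (@prn _ _ z0 _ _ x y)) := pr_fixed (in_V u).
rewrite -/w' prn_lie (W_prn_lie Ww n2p) add0r => /eqP.
rewrite linear0 scaler_eq0 (negPf z0_neq0) orbF -[prV (_ - _)]/(u - prV w').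
by rewrite linearBr subr_eq0 => /eqP E; rewrite sympC -E -sympC.
Qed.

(** [tau] and [T] are the off-diagonal blocks of [pr]; the sign of [T] makes [exp q] carry n into
    the fixed vectors. *)
Let tau u := prn (pr (in_V u)).
Let T a := - prV (pr (in_n a)).

Let tau_n2 u : tau u \in n2. Proof. exact: W_n2. Qed.

Let T_n2 a : a \in n2 -> T a = 0.
Proof. by move=> n2a; rewrite /T pr0 ?n2_fixed // !linear0. Qed.

Let q_fun (p : L) : L := in_n (tau (prV p)) + in_V (T (prn p)).

Let q_fun_linear : linear q_fun.
Proof.
have tauP a u v : tau (a *: u + v) = a *: tau u + tau v by rewrite /tau
  !linearP.
have TP a u v : T (a *: u + v) = a *: T u + T v.
  by rewrite /T (linearP in_n) (linearP pr) (linearP (@prV _ _ z0 _ _ x y))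
    opprD scalerN.
move=> a p r; rewrite /q_fun (linearP (@prn _ _ z0 _ _ x y)) (linearP (@prV _ _
  z0 _ _ x y)).
by rewrite tauP TP (linearP in_n) (linearP in_V) scalerDr addrACA.
Qed.

HB.instance Definition _ := GRing.isLinear.Build K L L *:%R q_fun q_fun_linear.

Let q : 'End(L) := linfun q_fun.

Let qE p : q p = in_n (tau (prV p)) + in_V (T (prn p)).
Proof. by rewrite lfunE. Qed.

Let q_V u : q (in_V u) = in_n (tau u).
Proof. by rewrite qE prV_V prn_V T_n2 ?mem0v // linear0 addr0. Qed.

Let q_n a : q (in_n a) = in_V (T a).
Proof. by rewrite qE prV_n prn_n /tau !linear0 add0r. Qed.

Let q_n2 a : a \in n2 -> q (in_n a) = 0.
Proof. by move=> n2a; rewrite q_n T_n2 // linear0. Qed.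

Let q_Der : q \in Der L.
Proof.
apply: (N_mix_Der n_charnil n_center2 z0_central z0_neq0 m_gt0 xy_basis).
apply/N_mixP; split=> [u|a|a n2a|u a].
- by exists (tau u); [apply: tau_n2 | apply: q_V].
- by exists (T a); apply: q_n.
- exact: q_n2.
rewrite [q (inV _ _ _ u)]q_V [q (inn _ _ _ a)]q_n lie_inn -[(in_V _).2]/(T a).
have E : lie (pr (in_V u)) (in_n a) = lie (pr (in_V u)) (pr (in_n a)).
  by apply/eqP; rewrite -subr_eq0 -linearBr /= W_fixed.
move/(congr1 (@prn _ _ z0 _ _ x y)): E;
  rewrite (W_lie (pr_W _) (pr_W _)) prn_lie prV_n linear0r scale0r addr0.
rewrite prn_n pr_V // -/(tau u) => ->.
by rewrite /T linearNr opprK; apply: linearZ.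
Qed.

Let q_lie p r : q (lie p r) = 0.
Proof.
have z0n2 := z0_n2 n_center2 z0_central.
by rewrite lie_LnE q_n2 // memvD ?memvZ ?lie_n2.
Qed.

Let q3 p : q (q (q p)) = 0.
Proof.
by rewrite [q p]qE linearD /= q_n2 // add0r q_V q_n2.
Qed.

Lemma straightening : exists phi psi : 'End(L),
  [/\ lie_morphism phi, cancel phi psi, cancel psi phi
    & {in S, forall d, (psi \o d \o phi)%VF \in sp_star z0 x y}].
Proof.
have qN_Der : - q \in Der L by rewrite memvN.
have qN_lie p r : (- q) (lie p r) = 0 by rewrite opp_lfunE q_lie oppr0.
have qN3 p : (- q) ((- q) ((- q) p)) = 0.
  have qN u : q (- u) = - q u by rewrite linearN.
  by rewrite !opp_lfunE !qN q3 !oppr0.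
pose phi := exp3 q; pose psi := exp3 (- q).
have phiM : lie_morphism phi := exp3_morphism charK q_Der q_lie q3.
have psiM : lie_morphism psi := exp3_morphism charK qN_Der qN_lie qN3.
have phiK : cancel phi psi := exp3K charK q3.
have psiK : cancel psi phi by move=> p; rewrite /phi -[q]opprK; apply: exp3K.
have phi_V u : phi (in_V u) = in_V u + in_n (tau u).
  by rewrite exp3E q_V q_n2 // scaler0 addr0.
(* [w] and [in_V (prV w)] differ by an element of [n2], which is fixed and killed by [pr]. *)
have pr_VW w : w \in W -> pr (in_V (prV w)) = w.
  move=> Ww; rewrite -[in_V (prV w)](addKr (in_n (prn w))) -Ln_decomp linearD
    /= (pr_id Ww).
  by rewrite [pr (- _)]pr0 ?add0r // memvN n2_fixed ?W_n2.
have phi_W w : w \in W -> phi (in_V (prV w)) = w.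
  by move=> Ww; rewrite phi_V addrC [RHS]Ln_decomp /tau pr_VW.
have psi_W w : w \in W -> psi w = in_V (prV w) by move=> /phi_W {1}<-;
  rewrite phiK.
(* With [w = pr (in_n a)], the image is [(in_n a - w) + in_n (prn w) - 1/2 in_n (prn w)]: a fixed
   vector plus elements of [n2]. *)
have phi_n a : phi (in_n a) \in fixed.
  rewrite exp3E q_n q_V; set w := pr (in_n a).
  have tauT : tau (T a) = - prn w.
    have prVN' u : pr (in_V (- u)) = - pr (in_V u) by rewrite linearN linearN.
    by rewrite /tau /T -/w prVN' pr_VW ?pr_W.
  have -> : in_V (T a) = in_n (prn w) - w.
    by rewrite [X in _ - X]Ln_decomp opprD addNKr /T -/w linearN.
  rewrite tauT [in_n (prn w) - w]addrC (addrA (in_n a)) -(addrA (in_n a - w));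
    apply: memvD; first exact: pr_fixed.
  have n2w : prn w \in n2 by apply: W_n2; apply: pr_W.
  by apply: memvD; [apply: n2_fixed | apply/memvZ/n2_fixed; rewrite memvN].
exists phi, psi; split=> // d Sd.
have dE p : (psi \o d \o phi)%VF p = psi (d (phi p)) by rewrite !comp_lfunE.
have dD : (psi \o d \o phi)%VF \in Der L.
  have /DerP dD := S_Der Sd.
  by apply/DerP => p r; rewrite !dE phiM dD linearD /= !psiM !phiK.
have [_ _ _ _ d5] := DerP' _ dD.
apply/sp_starP; split=> [u|u v|a]; last 2 first.
- exact: d5.
- by rewrite dE (fixedP _ (phi_n a)) // linear0.
by exists (prV (d (phi (in_V u)))); rewrite dE psi_W ?SW.
Qed.

End Straightening.

(** * Extensions by a Levi factor *)

Section PullbackAction.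
Variables (K : fieldType) (L : skewAlgType K) (g : lieType K) (R : {vspace g}).
Variable f : 'Hom(L, g).
Hypotheses (fM : lie_morphism f) (fK : lker f = 0%VS) (fR : limg f = R).
Hypothesis idR : ideal_of R fullv.

(** The adjoint action of [s] on the ideal [R], transported to [L] along the embedding [f]. *)
Definition pullback_fun (s : g) : 'End(L) := (f^-1 \o (ad s \o f))%VF.

Lemma pullback_linear : linear pullback_fun.
Proof.
move=> a s t; rewrite /pullback_fun linearP comp_lfunDl comp_lfunDr.
by rewrite -comp_lfunZl -comp_lfunZr.
Qed.

HB.instance Definition _ :=
  GRing.isLinear.Build K g 'End(L) *:%R pullback_fun pullback_linear.

Definition pullback : 'Hom(g, 'End(L)) := linfun pullback_fun.

Lemma embed_inj : injective f. Proof. by apply/lker0P; rewrite fK. Qed.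

Lemma embed_invK r : r \in R -> f (f^-1%VF r) = r.
Proof. by rewrite -fR; apply: limg_lfunVK. Qed.

Lemma memv_embed p : f p \in R. Proof. by rewrite -fR memv_img ?memvf. Qed.

Lemma pullbackE s p : f (pullback s p) = lie s (f p).
Proof.
rewrite lfunE /= /pullback_fun !comp_lfunE adE embed_invK //.
by apply: (subvP idR.2); rewrite memv_lie ?memvf ?memv_embed.
Qed.

Lemma pullback_Der s : pullback s \in Der L.
Proof.
apply/DerP => p q; apply: embed_inj; rewrite linearD /= !(pullbackE, fM).
by have /DerP := ad_Der s => /(_ (f p) (f q)); rewrite !adE.
Qed.

Lemma pullback_morphism s t : pullback (lie s t) = lie (pullback s) (pullback
  t).
Proof.
apply/lfunP => p; apply: embed_inj; rewrite lie_lfunE linearB /= !pullbackE.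
by have /DerP := ad_Der s => /(_ t (f p)); rewrite !adE => ->; rewrite addrK.
Qed.

Variable S : {vspace g}.
Hypotheses (subS : subalgebra S) (SR : (S + R = fullv)%VS) (SR0 : (S :&: R =
  0)%VS).
Hypothesis faithS : {in S, forall s, {in R, forall a, lie s a = 0} -> s = 0}.

Lemma pullback_eq0 s : s \in S -> pullback s = 0 -> s = 0.
Proof.
move=> Ss s0; apply: faithS => // a Ra.
by rewrite -(embed_invK Ra) -pullbackE s0 lfunE linear0.
Qed.

Local Notation S' := (pullback @: S)%VS.

Definition levi_iso_fun (u : g) : id_sum S' :=
  (vsproj S' (pullback (daddv_pi S R u)), f^-1%VF (daddv_pi R S u)).

Lemma levi_iso_linear : linear levi_iso_fun.
Proof. by move=> a u v; rewrite /levi_iso_fun !linearP. Qed.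

HB.instance Definition _ :=
  GRing.isLinear.Build K g (id_sum S') *:%R levi_iso_fun levi_iso_linear.

Lemma levi_split u : exists s p, s \in S /\ u = s + f p.
Proof.
have : u \in (S + R)%VS by rewrite SR memvf.
by case/memv_addP=> s Ss [r Rr ->]; exists s, (f^-1%VF r); rewrite embed_invK.
Qed.

Lemma levi_isoE s p : s \in S ->
  levi_iso_fun (s + f p) = (vsproj S' (pullback s), p) :> id_sum S'.
Proof.
move=> Ss; have RS0 : (R :&: S = 0)%VS by rewrite capvC.
have proj0 (U W : {vspace g}) u : (U :&: W = 0)%VS -> u \in W -> daddv_pi U W u
  = 0.
  move=> UW Wu; apply/eqP; rewrite -memv0 -UW memv_cap memv_pi.
  have := daddv_pi_add UW (subvP (addvSr U W) _ Wu);
    rewrite [daddv_pi W U u]daddv_pi_id //.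
    by move=> E; rewrite -[daddv_pi U W u](addrK u) E subrr mem0v.
  by rewrite capvC.
have Rp := memv_embed p.
have ES : daddv_pi S R (s + f p) = s.
  by rewrite linearD /= daddv_pi_id // (proj0 S R (f p)) // addr0.
have ER : daddv_pi R S (s + f p) = f p.
  by rewrite linearD /= (proj0 R S s) // add0r daddv_pi_id.
by rewrite /levi_iso_fun ES ER; congr (_, _); apply: embed_inj;
  rewrite embed_invK.
Qed.

(** The map sends [s + f p] to the pair of [pullback s] and [p]; faithfulness makes it injective. *)
Lemma levi_isomorphic : lie_isomorphic g (id_sum S').
Proof.
have S'p s : s \in S -> vsval (vsproj S' (pullback s)) = pullback s.
  by move=> Ss; rewrite vsprojK ?memv_img.
exists (linfun levi_iso_fun); split.
- move=> u v; have [s [p [Ss ->]]] := levi_split u;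
    have [t [q [St ->]]] := levi_split v.
  have E : lie (s + f p) (t + f q) =
      lie s t + f (lie p q + (pullback s q - pullback t p)).
    have -> : f (lie p q + (pullback s q - pullback t p)) =
        lie (f p) (f q) + (lie s (f q) + lie (f p) t).
      by rewrite linearD linearB /= fM !pullbackE (lieC (f p) t).
    rewrite linearDl !linearDr /= -addrA; congr (_ + _).
    by rewrite addrA addrC.
  have Sst : lie s t \in S by apply: (subvP subS); apply: memv_lie.
  rewrite !lfunE /= E !levi_isoE //; congr (_, _) => /=.
    by rewrite !S'p // pullback_morphism.
  by rewrite !S'p.
- apply/eqP; rewrite -subv0; apply/subvP => u; rewrite memv_ker lfunE /= memv0.
  have [s [p [Ss ->]]] := levi_split u; rewrite levi_isoE // => /eqP[s0 ->].
  have /(congr1 vsval) : vsproj S' (pullback s) = 0 by [].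
  by rewrite S'p // linear0 => /(pullback_eq0 Ss) ->; rewrite linear0 addr0.
apply/eqP; rewrite eqEsubv subvf; apply/subvP => -[d p] _.
have /memv_imgP[s Ss Ed] := subvsP d.
have -> : (d, p) = linfun levi_iso_fun (s + f p) :> id_sum S'.
  by rewrite lfunE /= levi_isoE //; congr (_, _); apply: subvs_inj; rewrite S'p.
by rewrite memv_img ?memvf.
Qed.

End PullbackAction.

Theorem proposition2p7 (K : fieldType) (charK : [pchar K] =i pred0)
    (n : lieType K) (n_charnil : characteristically_nilpotent n)
    (n_center2 : forall a : n,
       (forall c : n, lie a c \in center n) -> a \in lcs {:n} 2)
    (z0 : n) (z0_central : z0 \in center n) (z0_neq0 : z0 != 0)
    (m : nat) (m_gt0 : (0 < m)%N) (V : vectType K) (x y : m.-tuple V)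
    (xy_basis : basis_of {:V} (x ++ y)) :
  [/\ jacobi (Ln z0 x y), nilpotent {:Ln z0 x y}
    & exists t, nilindex {:n} t /\ nilindex {:Ln z0 x y} t]
  /\ (let N := (N_der z0 x y + N_mix z0 x y)%VS in
      [/\ Der (Ln z0 x y) = (sp_star z0 x y + N)%VS
            /\ (sp_star z0 x y :&: N = 0)%VS,
          (N_der z0 x y :&: N_mix z0 x y = 0)%VS,
          ideal_of N (Der (Ln z0 x y)) /\ nilpotent N
        & {in N, forall d : 'End(Ln z0 x y),
             exists k, forall p, iter k d p = 0}])
  /\ (forall (g : lieType K) (R : {vspace g}),
        faithful g -> is_radical R -> isomorphic_to_sub (Ln z0 x y) R ->
        exists S : {vspace 'End(Ln z0 x y)},
          [/\ (S <= sp_star z0 x y)%VS, semisimple S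
            & lie_isomorphic g (id_sum S)]).
Proof.
have Ndef := N_LnP n_charnil n_center2 z0_central z0_neq0 m_gt0 xy_basis.
have [nilL nilidx] := same_nilindex n_charnil n_center2 z0_central z0_neq0 x y.
split; first by split=> //; apply: Ln_jacobi.
split.
  split.
  - by split; [apply: Der_Ln | apply: sp_star_N0].
  - by apply: N_der_N_mix0.
  - by split; [apply: N_ideal | apply: N_nilpotent].
  - by apply: N_nilpotent_operators.
move=> g R [S [R0 [[radR0 ssS SR0 SR00] faithS]]] radR [f [fM fK fR]].
(* Faithfulness comes with its own radical, which equals [R] by maximality of both. *)
have ER : R0 = R.
  have [idR solR maxR] := radR; have [idR0 solR0 maxR0] := radR0.
  by apply/eqP; rewrite eqEsubv maxR ?maxR0.
rewrite {R0 radR0}ER in SR0 SR00 faithS.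
have [idR _ _] := radR.
pose S1 := (pullback f @: S)%VS.
have S1_Der : (S1 <= Der (Ln z0 x y))%VS.
  by apply/subvP => _ /memv_imgP[s _ ->]; apply: (pullback_Der fM fK fR idR).
have ss_img (f' : 'Hom(Ln z0 x y, g)) : lie_morphism f' -> lker f' = 0%VS ->
  limg f' = R ->
    semisimple (pullback f' @: S)%VS.
  move=> fM' fK' fR'; apply: limg_semisimple => //.
    by move=> s t _ _; apply: (pullback_morphism fK' fR' idR).
  apply/eqP; rewrite -subv0; apply/subvP => s /memv_capP[Ss];
    rewrite memv_ker => /eqP s0.
  by rewrite (pullback_eq0 fR' idR faithS Ss s0) mem0v.
have [phi [psi [phiM phiK psiK phi_sp]]] :=
  straightening charK n_charnil n_center2 z0_central z0_neq0 m_gt0 xy_basis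
    S1_Der (ss_img f fM fK fR).
(* Changing the embedding of the radical by the automorphism [phi] conjugates the action of [S] on
   L, which moves it into [sp_star]. *)
pose f' := (f \o phi)%VF.
have f'E p : f' p = f (phi p) by rewrite comp_lfunE.
have fM' : lie_morphism f' by move=> p q; rewrite !f'E phiM fM.
have fK' : lker f' = 0%VS.
  apply/eqP/lker0P => p q; rewrite !f'E => /(embed_inj fK)/(congr1 psi).
  by rewrite !phiK.
have fR' : limg f' = R.
  rewrite limg_comp -fR; congr (_ @: _)%VS; apply/eqP; rewrite eqEsubv subvf.
  by apply/subvP => p _; rewrite -(psiK p) memv_img ?memvf.
exists (pullback f' @: S)%VS; split.
- apply/subvP => _ /memv_imgP[s Ss ->].
  suff -> : pullback f' s = (psi \o pullback f s \o phi)%VF by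
    apply/phi_sp/memv_img.
  apply/lfunP => p; apply: (embed_inj fK');
    rewrite (pullbackE fR' idR) !f'E !comp_lfunE psiK.
  by rewrite (pullbackE fR idR).
- exact: ss_img.
- by apply: (levi_isomorphic fM' fK' fR' idR) => //; case: ssS.
Qed.
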